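(* For a strict partition $\nu=(\nu_1,\dots,\nu_r)$ of length $r\le n$, $Q^{\mathbb L}_\nu(x_1,\dots,x_n)$ is the coefficient of $u_1^{-\nu_1}\cdots u_r^{-\nu_r}$ in $$\prod_{i=1}^r\Big(\frac1{\mathscr P(u_i)}\prod_{j=1}^n\frac{u_i+_{\mathbb L}x_j}{u_i+_{\mathbb L}\bar x_j}\Big)\prod_{1\le i<j\le r}\frac{u_j+_{\mathbb L}\bar u_i}{u_j+_{\mathbb L}u_i}.$$
   Context: $\mathbb L$ is the Lazard ring, $F_{\mathbb L}(u,v)=u+v+\sum_{i,j\ge1}a_{i,j}u^iv^j$ the universal formal group law, $u+_{\mathbb L}v:=F_{\mathbb L}(u,v)$, $\bar u$ its formal inverse, $\mathscr P(z):=1+\sum_{i\ge1}a_{i,1}z^i$. $x_1,\dots,x_n$ indeterminates; $[x]^k:=(x+_{\mathbb L}x)x^{k-1}$. $Q^{\mathbb L}_\nu(x_1,\dots,x_n):=\sum_{\bar w\in S_n/(S_1)^r\times S_{n-r}}w\cdot\big[\prod_{i=1}^r[x_i]^{\nu_i}\prod_{i=1}^r\prod_{j=i+1}^n\frac{x_i+_{\mathbb L}x_j}{x_i+_{\mathbb L}\bar x_j}\big]$ ($S_n$ permuting the $x$'s, sum over coset representatives). Expansion convention: expand in powers of $x_1,\dots,x_n$ (denominators $u_i+_{\mathbb L}\bar x_j$ in powers of $x_j$); $1/\mathscr P(u_i)$ is a power series; for $i<j$, $1/(u_j+_{\mathbb L}u_i)$ is expanded in powers of $u_i$ with coefficients Laurent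 in $u_j$; the coefficient is taken in the resulting Laurent series ring in $u_1,\dots,u_r$. *)

(* Defs.v *)
From HB Require Import structures.
From mathcomp Require Import all_boot all_order all_algebra all_fingroup.
Set Implicit Arguments. Unset Strict Implicit. Unset Printing Implicit Defensive.
Import Order.TTheory GRing.Theory Num.Theory.
Local Open Scope ring_scope.

Record ops (A : Type) : Type :=
  Ops { o0 : A; o1 : A; oadd : A -> A -> A; oopp : A -> A; omul : A -> A -> A }.

Definition osum A (O : ops A) (F : nat -> A) (n : nat) : A :=
  foldr (fun i acc => oadd O (F i) acc) (o0 O) (iota 0 n).
Definition osumL A (O : ops A) (s : seq A) : A := foldr (oadd O) (o0 O) s.
Definition oprod A (O : ops A) (s : seq A) : A := foldr (omul O) (o1 O) s.

(* Formal Laurent series in one variable t over A: the pair (v, c)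
   represents  \sum_{k >= 0} c k t^(v + k). *)
Definition ser (A : Type) : Type := (int * (nat -> A))%type.

Definition scoef A (O : ops A) (f : ser A) (e : int) : A :=
  if f.1 <= e then f.2 (absz (e - f.1)) else o0 O.

Definition sops A (O : ops A) : ops (ser A) :=
  Ops ((0 : int), fun _ => o0 O)
      ((0 : int), fun k => if k == 0%N then o1 O else o0 O)
      (fun f g => let v := Num.min f.1 g.1 in
         (v, fun k => oadd O (scoef O f (v + k%:Z)) (scoef O g (v + k%:Z))))
      (fun f => (f.1, fun k => oopp O (f.2 k)))
      (fun f g => (f.1 + g.1,
         fun k => osum O (fun i => omul O (f.2 i) (g.2 (k - i)%N)) k.+1)).

Definition cst A (O : ops A) (x : A) : ser A :=
  ((0 : int), fun k => if k == 0%N then x else o0 O).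

(* inverse of the power series c (c 0 invertible with inverse a0) *)
Fixpoint ginv_seq A (O : ops A) (a0 : A) (c : nat -> A) (n : nat) : seq A :=
  match n with
  | 0 => [:: a0]
  | n'.+1 => let s := ginv_seq O a0 c n' in
      rcons s (omul O (oopp O a0)
                 (osum O (fun i => omul O (c i.+1) (nth (o0 O) s (n' - i)%N)) n))
  end.
Definition ginv A (O : ops A) (a0 : A) (c : nat -> A) : nat -> A :=
  fun k => nth (o0 O) (ginv_seq O a0 c k) k.

(* inverse of the Laurent series f = t^v (c 0 + c 1 t + ...), where
   a0 is the inverse of the leading coefficient c 0 *)
Definition sinv A (O : ops A) (a0 : A) (f : ser A) : ser A :=
  (- f.1, ginv O a0 f.2).

Section Series.
Variable R : comPzRingType.

(* Iterated series ring with d layers: layer 0 innermost, layer d-1 outermost.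
   T d = ser (ser (... (ser R))). *)
Fixpoint T (d : nat) : Type := match d with 0 => R | d'.+1 => ser (T d') end.

Definition opsR : ops R := Ops 0 1 (@GRing.add R) (@GRing.opp R) (@GRing.mul R).

Fixpoint opsT (d : nat) : ops (T d) :=
  match d return ops (T d) with 0 => opsR | d'.+1 => sops (opsT d') end.

Fixpoint liftR (d : nat) (x : R) : T d :=
  match d return T d with 0 => x | d'.+1 => cst (opsT d') (liftR d' x) end.

(* place an element built at layer be (as a series in the variable of layer be
   with coefficients in the inner layers) into T d *)
Fixpoint place (d be : nat) (B : forall k, ser (T k)) : T d :=
  match d return T d with
  | 0 => 0
  | d'.+1 => if d' == be then B d' else cst (opsT d') (place d' be B)
  end.

Fixpoint coefT (d : nat) : T d -> (nat -> int) -> R :=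
  match d return T d -> (nat -> int) -> R with
  | 0 => fun f _ => f
  | d'.+1 => fun f e => coefT (scoef (opsT d') f (e d')) e
  end.

Definition ps : Type := nat -> R.
Definition psmul (f g : ps) : ps := fun m => \sum_(i < m.+1) f i * g (m - i)%N.
Fixpoint pspow (f : ps) (k : nat) : ps :=
  match k with 0 => fun m => (m == 0%N)%:R | k'.+1 => psmul f (pspow f k') end.
(* composition f(h(z)), for h with zero constant term *)
Definition pscomp (f h : ps) : ps := fun m => \sum_(k < m.+1) f k * pspow h k m.
Definition psinv (a0 : R) (c : ps) : ps := ginv opsR a0 c.
Definition X1 : ps := fun m => (m == 1%N)%:R.

Definition serV (d al : nat) (v : int) (c : ps) : T d :=
  place d al (fun k => (v, fun i => liftR k (c i))).

(* F_cc(h(y_al), g(y_be)) = sum_{k,l} cc k l h(y_al)^k g(y_be)^l, al < be,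
   expanded as a series in y_be with coefficients series in y_al.
   Layer-be form: *)
Definition FioL (k : nat) (cc : nat -> nat -> R) (al : nat) (h g : ps) : ser (T k) :=
  ((0 : int), fun m => osum (opsT k)
      (fun l => omul (opsT k) (liftR k (pspow g l m))
                                (serV k al 0 (pscomp (fun i => cc i l) h))) m.+1).

(* F(u,v) = u + v + sum_{i,j>=1} a i j u^i v^j  ;  fglc a k l = coeff of u^k v^l *)
Definition fglc (a : nat -> nat -> R) (k l : nat) : R :=
  if k == 0%N then (l == 1%N)%:R
  else if l == 0%N then (k == 1%N)%:R else a k l.

Definition ps2mul (f g : nat -> nat -> R) : nat -> nat -> R :=
  fun p q => \sum_(i < p.+1) \sum_(j < q.+1) f i j * g (p - i)%N (q - j)%N.
Fixpoint ps2pow (f : nat -> nat -> R) (k : nat) : nat -> nat -> R :=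
  match k with
  | 0 => fun p q => ((p == 0%N) && (q == 0%N))%:R
  | k'.+1 => ps2mul f (ps2pow f k')
  end.

(* F(F(u,v),w) = F(u,F(v,w)), coefficient of u^p v^q w^s *)
Definition fgl_assoc (a : nat -> nat -> R) : Prop :=
  forall p q s : nat,
    \sum_(k < (p + q).+1) fglc a k s * ps2pow (fglc a) k p q
    = \sum_(k < (q + s).+1) fglc a p k * ps2pow (fglc a) k q s.

Definition fgl_comm (a : nat -> nat -> R) : Prop := forall i j, a i j = a j i.

Definition is_formal_inverse (a : nat -> nat -> R) (io : ps) : Prop :=
  io 0%N = 0 /\
  forall m : nat,
    \sum_(k < m.+1) \sum_(l < m.+1) fglc a k l * pspow io l (m - k)%N = 0.

(* h(y_al) +_F g(y_be) in T d, for al <> be, h g with zero constant term *)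
Definition Fsub (a : nat -> nat -> R) (d al : nat) (h : ps) (be : nat) (g : ps) : T d :=
  if (al < be)%N then place d be (fun k => FioL k (fglc a) al h g)
  else place d al (fun k => FioL k (fun i j => fglc a j i) be g h).

(* 1 / (h(y_al) +_F g(y_be)), expanded in the outer one of the two variables.
   hq (resp. gq) is the inverse of h(z)/z (resp. g(z)/z). *)
Definition Fsubinv (a : nat -> nat -> R) (d al : nat) (h hq : ps) (be : nat) (g gq : ps)
  : T d :=
  if (al < be)%N then
    place d be (fun k => sinv (opsT k) (serV k al (-1) hq) (FioL k (fglc a) al h g))
  else
    place d al (fun k => sinv (opsT k) (serV k be (-1) gq)
                              (FioL k (fun i j => fglc a j i) be g h)).

Definition hqX : ps := psinv 1 (fun k => X1 k.+1).
(* io(z) = -z + ..., so io(z)/z has leading coefficient -1 *)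
Definition hqio (io : ps) : ps := psinv (-1) (fun k => io k.+1).

(* [x]^k = (x +_F x) x^(k-1) *)
Definition brk (a : nat -> nat -> R) (k : nat) : ps :=
  psmul (fun m => \sum_(i < m.+1) fglc a i (m - i)%N) (pspow X1 k.-1).

Definition Pinv (a : nat -> nat -> R) : ps :=
  psinv 1 (fun k => if k == 0%N then 1 else a k 1%N).

(* Ring T n: x_j (j = 0..n-1) is the variable of layer j.  Each (rational)
   summand is expanded in the iterated Laurent series ring
   R((x_0))((x_1))...((x_{n-1})); the (power series) sum is independent of
   this choice. *)
Definition coset_rep (n r : nat) (w : {perm 'I_n}) : bool :=
  [forall k : 'I_n, forall k' : 'I_n, ((r <= k) && (k < k'))%N ==> (w k < w k')%N].

Definition Qterm (a : nat -> nat -> R) (io : ps) (n : nat) (nu : seq nat)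
    (w : {perm 'I_n}) : T n :=
  let r := size nu in let O := opsT n in
  omul O
    (oprod O [seq serV n (w i) 0 (brk a (nth 0%N nu i)) | i : 'I_n <- enum 'I_n & (i < r)%N])
    (oprod O [seq omul O (Fsub a n (w ij.1) X1 (w ij.2) X1)
                         (Fsubinv a n (w ij.1) X1 hqX (w ij.2) io (hqio io))
             | ij : 'I_n * 'I_n <- [seq (i, j) | i : 'I_n <- enum 'I_n, j : 'I_n <- enum 'I_n]
             & ((ij.1 < r) && (ij.1 < ij.2))%N]).

(* sum over w in S_n / (S_1)^r x S_{n-r}, representatives: w increasing on
   {r, ..., n-1} (0-based) *)
Definition QL (a : nat -> nat -> R) (io : ps) (n : nat) (nu : seq nat) : T n :=
  osumL (opsT n) [seq Qterm a io nu w | w : {perm 'I_n} <- enum {perm 'I_n} & coset_rep (size nu) w].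

(* Ring T (r + n): u_i (i = 0..r-1, i.e. u_{i+1} of the paper) is the variable of
   layer r-1-i, x_j the variable of layer r+j.  Thus the ring is
   (R((u_r))((u_{r-1}))...((u_1)))[[x_1,...,x_n]]: for i<j, 1/(u_j + u_i) is
   expanded in powers of u_i, and 1/(u_i + xbar_j) in powers of x_j. *)
Definition Gen (a : nat -> nat -> R) (io : ps) (n : nat) (nu : seq nat)
  : T (size nu + n) :=
  let r := size nu in let D := (r + n)%N in let O := opsT D in
  let ul i := (r - 1 - i)%N in let xl j := (r + j)%N in
  omul O
    (oprod O [seq omul O (serV D (ul i) 0 (Pinv a))
                (oprod O [seq omul O (Fsub a D (ul i) X1 (xl j) X1)
                                     (Fsubinv a D (ul i) X1 hqX (xl j) io (hqio io))
                         | j <- iota 0 n])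
             | i <- iota 0 r])
    (oprod O [seq omul O (Fsub a D (ul ij.2) X1 (ul ij.1) io)
                         (Fsubinv a D (ul ij.2) X1 hqX (ul ij.1) X1 hqX)
             | ij <- [seq (i, j) | i <- iota 0 r, j <- iota 0 r]
             & (ij.1 < ij.2)%N]).

Definition gen_exp (nu : seq nat) (e : nat -> int) : nat -> int :=
  fun k => if (k < size nu)%N then - ((nth 0%N nu (size nu - 1 - k)%N)%:Z)
           else e (k - size nu)%N.

End Series.

(* Main.v *)
Require Import Defs.
From HB Require Import structures.
From mathcomp Require Import all_boot all_order all_algebra all_fingroup.
From mathcomp Require Import boolp classical_sets.
From mathcomp Require Import ring zify.
Set Implicit Arguments. Unset Strict Implicit. Unset Printing Implicit Defensive.
Import Order.TTheory GRing.Theory Num.Theory.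
Local Open Scope ring_scope.

(* Induction on r, extracting the coefficient of u_1^(-nu_1) first.  As nu_1 > 0
   and u_1 is smaller than the other u_i but larger than the x_j, this coefficient
   is the sum of the residues of f u_1^(nu_1 - 1) at the simple poles u_1 = x_j.
   Write u +_L bar x = (u - x) U(u, x); associativity gives U(x, x) P(x) = 1, so
   that the residue at x_j is [x_j]^nu_1 times the product over k <> j of
   (x_j +_L x_k) / (x_j +_L bar x_k), times a factor (u_i +_L bar x_j) / (u_i +_L x_j)
   for every i > 1 that cancels x_j from the remaining generating function.
   Unfolding the recursion yields a sum over the sequences of r distinct indices,
   that is, over the coset representatives.

   Residues are computed without infinite sums: the value of f at u = x is the
   element b free of u such that f - b is (u - x) times a series regular in u,
   and 1 / prod_j (u - x_j) is split into partial fractions. *)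

(** * Laurent series over a commutative ring *)

(** A series has many representing pairs in [ser], so [T d] is not a ring under equality. All
    computations are therefore moved along [phi] to [LL d], a commutative ring in which series with
    equal coefficients are equal. Inverses are unique there. Hence the expansion convention is
    carried by the order of the layers alone, and the explicit expansion of an inverse matters only
    for seeing which variables occur in it without negative powers. The layer of [u_1] lies between
    those of the other [u_i] and those of the [x_j], so its coefficient cannot be read off the
    outermost layer: [ins_at] and [coef_at] insert and remove a layer in the middle, and values of
    series are taken relative to that layer. The base ring is an arbitrary commutative ring, so no
    cancellation is available: every quotient comes with an explicit inverse, and vanishing on the
    diagonal is turned into divisibility by writing down the quotient coefficient by coefficient. *)

Section Window.
Variable A : nmodType.
Implicit Types (G : int -> A) (lo x : int) (N : nat).

Definition wsum lo N G : A := \sum_(i < N) G (lo + i%:Z).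

Lemma wsum_widen lo N lo' N' G :
  (forall x, x < lo -> G x = 0) -> (forall x, lo + N%:Z <= x -> G x = 0) ->
  lo' <= lo -> lo + N%:Z <= lo' + N'%:Z -> wsum lo' N' G = wsum lo N G.
Proof.
move=> Glo Ghi le1 le2; rewrite /wsum.
have ->: N' = (absz (lo - lo')%R + (N + (N' - N - absz (lo - lo')%R)))%N by lia.
rewrite big_split_ord /= big1 ?add0r; last first.
  by move=> i _; apply: Glo; have := ltn_ord i; lia.
rewrite big_split_ord /= [X in _ + X]big1 ?addr0; last first.
  by move=> i _; apply: Ghi; lia.
by apply: eq_bigr => i _; congr G; lia.
Qed.

(** Both windows extend to a common one, which only adds zero terms. This makes products of series
    independent of the bounds chosen for the factors. *)
Lemma wsum_indep lo N lo' N' G :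
  (forall x, x < lo -> G x = 0) -> (forall x, lo + N%:Z <= x -> G x = 0) ->
  (forall x, x < lo' -> G x = 0) -> (forall x, lo' + N'%:Z <= x -> G x = 0) ->
  wsum lo N G = wsum lo' N' G.
Proof.
move=> G1 G2 G3 G4; pose m := Num.min lo lo'.
pose M := absz (Num.max (lo + N%:Z) (lo' + N'%:Z) - m)%R.
rewrite -(@wsum_widen lo N m M) -1?(@wsum_widen lo' N' m M) // /M /m; lia.
Qed.

End Window.

Definition lbounded (A : nmodType) (F : int -> A) : Prop :=
  exists v : int, forall e : int, e < v -> F e = 0.

(** A bound of the support exists but is not stored, so that a series is determined by its
    coefficients ([laurentP]). *)
Definition laurent (A : comPzRingType) : Type := {F : int -> A | lbounded F}.

Section Laurent.
Variable A : comPzRingType.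
Implicit Types (f g h : laurent A) (F : int -> A) (e v x : int).

Definition coef f : int -> A := sval f.

Lemma lbounded0 : lbounded (fun _ : int => 0 : A). Proof. by exists 0. Qed.

(* The junk value is 0 when F is not bounded below. *)
Definition mkL F : laurent A :=
  match pselect (lbounded F) with
  | left H => exist _ F H
  | right _ => exist _ _ lbounded0
  end.

Lemma coef_mkL F : lbounded F -> coef (mkL F) = F.
Proof. by rewrite /mkL; case: pselect. Qed.

Lemma coef_bounded f : lbounded (coef f). Proof. exact: svalP f. Qed.

Lemma laurentP f g : (forall e, coef f e = coef g e) -> f = g.
Proof.
case: f g => [F HF] [G HG] /= /funext E; rewrite /coef /= in E.
by case: G / E HG => HG; congr exist; apply: Prop_irrelevance.
Qed.

HB.instance Definition _ := gen_eqMixin (laurent A).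
HB.instance Definition _ := gen_choiceMixin (laurent A).

Definition lzero : laurent A := mkL (fun _ => 0).
Definition lone : laurent A := mkL (fun e => (e == 0)%:R).
Definition ladd f g := mkL (fun e => coef f e + coef g e).
Definition lopp f := mkL (fun e => - coef f e).
(** An arbitrary bound picked by [cid], not the order of [f]; hence the need for [coef_lmul], which
    frees the product from it. *)
Definition lval f : int := projT1 (cid (coef_bounded f)).
Definition lmul f g := mkL (fun e =>
  wsum (lval f) (absz (Num.max 0 (e - lval f - lval g + 1))%R)
    (fun x => coef f x * coef g (e - x))).

Lemma lvalP f e : e < lval f -> coef f e = 0.
Proof. by rewrite /lval; case: cid => v /= H; apply: H. Qed.

Lemma coef_lzero e : coef lzero e = 0.
Proof. by rewrite coef_mkL //; exact: lbounded0. Qed.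
Lemma coef_lone e : coef lone e = (e == 0)%:R.
Proof.
rewrite coef_mkL //; exists 0 => x xlt0.
by rewrite lt_eqF.
Qed.
Lemma coef_ladd f g e : coef (ladd f g) e = coef f e + coef g e.
Proof.
rewrite coef_mkL //; exists (Num.min (lval f) (lval g)) => x xlt.
by rewrite !lvalP ?addr0 //; lia.
Qed.
Lemma coef_lopp f e : coef (lopp f) e = - coef f e.
Proof.
by rewrite coef_mkL //; exists (lval f) => x xlt; rewrite !lvalP ?oppr0.
Qed.

Lemma coef_lmul_lt f g e : e < lval f + lval g -> coef (lmul f g) e = 0.
Proof.
have H: forall e, e < lval f + lval g ->
   wsum (lval f) (absz (Num.max 0 (e - lval f - lval g + 1))%R)
    (fun x => coef f x * coef g (e - x)) = 0.
  move=> e' le'; rewrite (_ : absz _ = 0%N); last by lia.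
  by rewrite /wsum big_ord0.
by move=> le; rewrite coef_mkL ?H //; exists (lval f + lval g).
Qed.

Lemma coef_lmul f g lo N e :
  (forall x, x < lo -> coef f x = 0) ->
  (forall x, lo + N%:Z <= x -> coef g (e - x) = 0) ->
  coef (lmul f g) e = \sum_(i < N) coef f (lo + i%:Z) * coef g (e - (lo + i%:Z)).
Proof.
move=> Hf Hg; rewrite coef_mkL; last first.
  exists (lval f + lval g) => e' le'; rewrite (_ : absz _ = 0%N); last by lia.
  by rewrite /wsum big_ord0.
apply: wsum_indep => x Hx; first by rewrite lvalP ?mul0r.
- by rewrite [coef g _]lvalP ?mulr0 //; lia.
- by rewrite Hf ?mul0r.
- by rewrite Hg ?mulr0.
Qed.

Lemma lmulC f g : lmul f g = lmul g f.
Proof.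
apply: laurentP => e; set N := absz (Num.max 0 (e - lval f - lval g + 1))%R.
rewrite (@coef_lmul f g (lval f) N); first last.
- by move=> x; rewrite /N => Hx; apply: lvalP; lia.
- exact: lvalP.
rewrite (@coef_lmul g f (lval g) N); first last.
- by move=> x; rewrite /N => Hx; apply: lvalP; lia.
- exact: lvalP.
rewrite (reindex_inj rev_ord_inj) /=; apply: eq_bigr => i _.
by rewrite mulrC; have := ltn_ord i; rewrite /N => ?; congr (coef _ _ * coef _ _); lia.
Qed.

Lemma lmulA f g h : lmul f (lmul g h) = lmul (lmul f g) h.
Proof.
apply: laurentP => e.
set N := absz (Num.max 0 (e - lval f - lval g - lval h + 1))%R.
rewrite (@coef_lmul f _ (lval f) N); first last.
- by move=> x; rewrite /N => Hx; apply: coef_lmul_lt; lia.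
- exact: lvalP.
rewrite (@coef_lmul _ h (lval f + lval g) N); first last.
- by move=> x; rewrite /N => Hx; apply: lvalP; lia.
- exact: coef_lmul_lt.
transitivity (\sum_(j < N) \sum_(i < N) coef f (lval f + j%:Z) *
   (coef g (lval g - j%:Z + i%:Z) * coef h (e - lval f - lval g - i%:Z))); last first.
  rewrite exchange_big; apply: eq_bigr => i _ /=.
  rewrite (@coef_lmul f g (lval f) N); first last.
  - by move=> x Hx; apply: lvalP; have := ltn_ord i; lia.
  - exact: lvalP.
  rewrite mulr_suml; apply: eq_bigr => j _; rewrite mulrA.
  by congr (_ * coef _ _ * coef _ _); lia.
apply: eq_bigr => j _; rewrite -mulr_sumr; congr (_ * _).
rewrite (@coef_lmul g h (lval g) N); first last.
- by move=> x; rewrite /N => Hx; apply: lvalP; lia.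
- exact: lvalP.
(* In the common double sum the window of [g] starts at [lval g - j] instead of [lval g]; both
   windows contain all nonzero terms. *)
transitivity (wsum (lval g - j%:Z) N
   (fun x => coef g x * coef h (e - (lval f + j%:Z) - x))); last first.
  by apply: eq_bigr => i _; congr (_ * coef _ _); lia.
apply: wsum_indep => x; have := ltn_ord j; rewrite /N => ? Hx.
- by rewrite lvalP ?mul0r.
- by rewrite [coef h _]lvalP ?mulr0 //; lia.
- by rewrite lvalP ?mul0r //; lia.
- by rewrite [coef h _]lvalP ?mulr0 //; lia.
Qed.

Lemma lmul1 f : lmul lone f = f.
Proof.
apply: laurentP => e; rewrite (@coef_lmul _ _ 0 (absz (Num.max 0 (e - lval f + 1))%R).+1).
- rewrite big_ord_recl big1 => [|i _]; last first.
    by rewrite lift0 coef_lone (_ : (_ == _) = false) ?mul0r //; lia.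
  by rewrite coef_lone /= mul1r addr0; congr (coef _ _); lia.
- by move=> x xlt; rewrite coef_lone lt_eqF.
- by move=> x Hx; apply: lvalP; lia.
Qed.

Lemma lmulDl f g h : lmul (ladd f g) h = ladd (lmul f h) (lmul g h).
Proof.
apply: laurentP => e; rewrite coef_ladd; set lo := Num.min (lval f) (lval g).
set N := absz (Num.max 0 (e - lo - lval h + 1))%R.
have HN x : lo + N%:Z <= x -> coef h (e - x) = 0.
  by move=> Hx; apply: lvalP; rewrite /N in Hx; lia.
rewrite (@coef_lmul _ _ lo N) // => [|x Hx]; last first.
  by move: Hx; rewrite /lo => Hx; rewrite coef_ladd !lvalP ?addr0 //; lia.
rewrite (@coef_lmul f _ lo N) // => [|x Hx]; last by apply: lvalP; move: Hx; rewrite /lo; lia.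
rewrite (@coef_lmul g _ lo N) // => [|x Hx]; last by apply: lvalP; move: Hx; rewrite /lo; lia.
by rewrite -big_split; apply: eq_bigr => i _; rewrite coef_ladd mulrDl.
Qed.

Lemma laddA : associative ladd.
Proof. by move=> f g h; apply: laurentP => e; rewrite !coef_ladd addrA. Qed.
Lemma laddC : commutative ladd.
Proof. by move=> f g; apply: laurentP => e; rewrite !coef_ladd addrC. Qed.
Lemma ladd0 : left_id lzero ladd.
Proof. by move=> f; apply: laurentP => e; rewrite !coef_ladd coef_lzero add0r. Qed.
Lemma laddN : left_inverse lzero lopp ladd.
Proof.
by move=> f; apply: laurentP => e; rewrite coef_ladd coef_lopp coef_lzero addNr.
Qed.

HB.instance Definition _ := GRing.isZmodule.Build (laurent A) laddA laddC ladd0 laddN.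
HB.instance Definition _ :=
  GRing.Zmodule_isComPzRing.Build (laurent A) lmulA lmulC lmul1 lmulDl.

Lemma coef0 e : coef 0 e = 0. Proof. exact: coef_lzero. Qed.
Lemma coef1 e : coef 1 e = (e == 0)%:R. Proof. exact: coef_lone. Qed.
Lemma coefD f g e : coef (f + g) e = coef f e + coef g e.
Proof. exact: coef_ladd. Qed.
Lemma coefN f e : coef (- f) e = - coef f e. Proof. exact: coef_lopp. Qed.
Lemma coefB f g e : coef (f - g) e = coef f e - coef g e.
Proof. by rewrite coefD coefN. Qed.
Lemma coefM f g lo N e :
  (forall x, x < lo -> coef f x = 0) ->
  (forall x, lo + N%:Z <= x -> coef g (e - x) = 0) ->
  coef (f * g) e = \sum_(i < N) coef f (lo + i%:Z) * coef g (e - (lo + i%:Z)).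
Proof. exact: coef_lmul. Qed.
Lemma coef_sum (I : Type) (r : seq I) (P : pred I) (G : I -> laurent A) e :
  coef (\sum_(i <- r | P i) G i) e = \sum_(i <- r | P i) coef (G i) e.
Proof.
by elim/big_rec2: _ => [|i y1 y2 _ <-]; [exact: coef0 | rewrite coefD].
Qed.

End Laurent.

(** * Iterated Laurent series *)

Section Coefficientwise.
Variables A B : comPzRingType.

Definition lcst (x : A) : laurent A := mkL (fun e => if e == 0 then x else 0).

Lemma coef_lcst x e : coef (lcst x) e = if e == 0 then x else 0.
Proof. by rewrite coef_mkL //; exists 0 => e' lt; rewrite lt_eqF. Qed.

Lemma coef_lcstM x (f : laurent A) e : coef (lcst x * f) e = x * coef f e.
Proof.
rewrite (@coefM _ _ _ 0 (absz (Num.max 0 (e - lval f + 1))%R).+1).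
- rewrite big_ord_recl big1 => [|i _]; last first.
    by rewrite lift0 coef_lcst (_ : (_ == _) = false) ?mul0r //; lia.
  by rewrite coef_lcst /= addr0; congr (_ * coef _ _); lia.
- by move=> y ylt; rewrite coef_lcst lt_eqF.
- by move=> y Hy; apply: lvalP; lia.
Qed.

Lemma lcst_is_zmod_morphism : zmod_morphism lcst.
Proof.
move=> x y; apply: laurentP => e; rewrite coefB !coef_lcst.
by case: eqP => //; rewrite subr0.
Qed.
Lemma lcst_is_monoid_morphism : monoid_morphism lcst.
Proof.
split=> [|x y]; apply: laurentP => e; first by rewrite coef1 coef_lcst; case: eqP.
by rewrite coef_lcstM !coef_lcst; case: eqP => //; rewrite mulr0.
Qed.
HB.instance Definition _ := GRing.isZmodMorphism.Build A (laurent A) lcst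
  lcst_is_zmod_morphism.
HB.instance Definition _ := GRing.isMonoidMorphism.Build A (laurent A) lcst
  lcst_is_monoid_morphism.

Definition Lmap (g : A -> B) (f : laurent A) : laurent B := mkL (fun e => g (coef f e)).

Lemma coef_Lmap (g : A -> B) f e : g 0 = 0 -> coef (Lmap g f) e = g (coef f e).
Proof. by move=> g0; rewrite coef_mkL //; exists (lval f) => x /lvalP ->. Qed.

Lemma Lmap_is_zmod_morphism (g : A -> B) : zmod_morphism g -> zmod_morphism (Lmap g).
Proof.
move=> gB f h; have g0 : g 0 = 0 by have := gB 0 0; rewrite !subrr.
by apply: laurentP => e; rewrite coefB !coef_Lmap // coefB gB.
Qed.

End Coefficientwise.

(* A semi-linear pairing identity on coefficients passes to Laurent series;
   both multiplicativity of Lmap and linearity of coefficient maps are instances. *)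
Lemma LmapM (A B C : comPzRingType) (g : A -> B) (h : C -> A) (k : C -> B) :
  zmod_morphism g -> zmod_morphism h -> zmod_morphism k ->
  (forall x y, g (h x * y) = k x * g y) ->
  forall x y, Lmap g (Lmap h x * y) = Lmap k x * Lmap g y.
Proof.
move=> gB hB kB E x y.
have g0 : g 0 = 0 by have := gB 0 0; rewrite !subrr.
have h0 : h 0 = 0 by have := hB 0 0; rewrite !subrr.
have k0 : k 0 = 0 by have := kB 0 0; rewrite !subrr.
have gD u v : g (u + v) = g u + g v.
  have gN w : g (- w) = - g w by rewrite -sub0r gB g0 sub0r.
  by rewrite -[v in LHS]opprK gB gN opprK.
apply: laurentP => e; rewrite coef_Lmap //.
set N := absz (Num.max 0 (e - lval x - lval y + 1))%R.
rewrite !(@coefM _ _ _ (lval x) N); first last.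
- by move=> z; rewrite /N => Hz; apply: lvalP; lia.
- by move=> z Hz; rewrite coef_Lmap // lvalP.
- by move=> z; rewrite /N => Hz; rewrite coef_Lmap // lvalP //; lia.
- by move=> z Hz; rewrite coef_Lmap // lvalP.
elim/big_rec2: _ => [//|i u v _ <-].
by rewrite gD !coef_Lmap // E.
Qed.

Section Iterated.
Variable R : comPzRingType.

Fixpoint LL (d : nat) : comPzRingType :=
  match d with 0 => R | d'.+1 => (laurent (LL d') : comPzRingType) end.

Fixpoint mcoef (d : nat) : LL d -> (nat -> int) -> R :=
  match d return LL d -> (nat -> int) -> R with
  | 0 => fun f _ => f
  | d'.+1 => fun f e => mcoef (coef (f : laurent (LL d')) (e d')) e
  end.

Lemma mcoefS d (f : LL d.+1) e : mcoef f e = mcoef (coef (f : laurent (LL d)) (e d)) e.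
Proof. by []. Qed.

Lemma mcoefP d (f g : LL d) : (forall e, mcoef f e = mcoef g e) -> f = g.
Proof.
elim: d f g => [|d IH] f g H; first exact: (H (fun=> 0)).
apply: laurentP => x; apply: IH => e.
pose e' k := if k == d then x else e k.
suff Hm (h : LL d) : mcoef h e = mcoef h e'.
  by have := H e'; rewrite /= {1 3}/e' eqxx -!Hm.
suff Hk k (h' : LL k) : (k <= d)%N -> mcoef h' e = mcoef h' e' by exact: Hk.
elim: k h' => [//|k IHk] h' ltk /=.
have -> : e' k = e k by rewrite /e' ltn_eqF.
by rewrite IHk // ltnW.
Qed.

Lemma eq_mcoef d (f : LL d) e e' : (forall k, (k < d)%N -> e k = e' k) ->
  mcoef f e = mcoef f e'.
Proof.
elim: d f => [//|d IH] f H /=; rewrite H //; apply: IH => k ltk.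
by apply: H; rewrite ltnS ltnW.
Qed.

Lemma mcoef_is_zmod_morphism d e : zmod_morphism (fun f : LL d => mcoef f e).
Proof.
elim: d => [//|d IH] f g /=.
by rewrite -[RHS]IH; congr mcoef; exact: coefB.
Qed.

Lemma mcoefB d (f g : LL d) e : mcoef (f - g) e = mcoef f e - mcoef g e.
Proof. exact: mcoef_is_zmod_morphism. Qed.
Lemma mcoef0 d e : mcoef (0 : LL d) e = 0.
Proof. by rewrite -(subrr 0) mcoefB subrr. Qed.
Lemma mcoefD d (f g : LL d) e : mcoef (f + g) e = mcoef f e + mcoef g e.
Proof. by rewrite -[g in LHS]opprK mcoefB -[in LHS]sub0r mcoefB mcoef0 sub0r opprK. Qed.
Lemma mcoef_sum d (I : Type) (r : seq I) (P : pred I) (G : I -> LL d) e :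
  mcoef (\sum_(i <- r | P i) G i) e = \sum_(i <- r | P i) mcoef (G i) e.
Proof.
by elim/big_rec2: _ => [|i y1 y2 _ <-]; [exact: mcoef0 | rewrite mcoefD].
Qed.

Lemma mcoef_lcst d (f : LL d) (e : nat -> int) :
  mcoef (lcst f : LL d.+1) e = if e d == 0 then mcoef f e else 0.
Proof. by rewrite /= coef_lcst; case: eqP => // _; rewrite mcoef0. Qed.

(** Makes room for a new variable at level [i]: the image is free of it, and the old levels from [i]
    on move up, following [bump i]. *)
Fixpoint ins_at (i d : nat) : LL d -> LL d.+1 :=
  match d return LL d -> LL d.+1 with
  | 0 => fun f => lcst (f : R)
  | d'.+1 => fun f => if i == d'.+1 then lcst (f : LL d'.+1)
                      else Lmap (@ins_at i d') (f : laurent (LL d'))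
  end.

(** The layers above [i] are traversed coefficientwise, since the variable to be extracted need not
    be the outermost one. *)
Fixpoint coef_at (i : nat) (x : int) (d : nat) : LL d.+1 -> LL d :=
  match d return LL d.+1 -> LL d with
  | 0 => fun f => coef (f : laurent R) x
  | d'.+1 => fun f => if i == d'.+1 then coef (f : laurent (LL d'.+1)) x
                      else Lmap (@coef_at i x d') (f : laurent (LL d'.+1))
  end.

Lemma ins_at_is_zmod_morphism i d : zmod_morphism (@ins_at i d).
Proof.
elim: d => [|d IH] f g /=; first exact: (raddfB (@lcst R)).
case: eqP => _; first exact: (raddfB (@lcst (LL d.+1))).
exact: Lmap_is_zmod_morphism.
Qed.

Lemma ins_at_is_monoid_morphism i d : monoid_morphism (@ins_at i d).
Proof.
elim: d => [|d [IH1 IHM]]; split => [|f g] /=.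
- exact: (rmorph1 (@lcst R)).
- exact: (rmorphM (@lcst R)).
- case: eqP => _; first exact: (rmorph1 (@lcst (LL d.+1))).
  apply: laurentP => e; have Z := @ins_at_is_zmod_morphism i d.
  rewrite coef_Lmap; last by have := Z 0 0; rewrite !subrr.
  rewrite !coef1; case: eqP => _; first exact: IH1.
  by have := Z 0 0; rewrite !subrr.
- case: eqP => _; first exact: (rmorphM (@lcst (LL d.+1))).
  have idB : zmod_morphism (@id (LL d)) by [].
  have Z := @ins_at_is_zmod_morphism i d.
  have E (h : laurent (LL d)) : Lmap id h = h.
    by apply: laurentP => x; rewrite coef_Lmap.
  have := @LmapM _ _ _ (@ins_at i d) id (@ins_at i d) Z idB Z IHM f g.
  by rewrite E.
Qed.

HB.instance Definition _ i d := GRing.isZmodMorphism.Build (LL d) (LL d.+1)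
  (@ins_at i d) (@ins_at_is_zmod_morphism i d).
HB.instance Definition _ i d := GRing.isMonoidMorphism.Build (LL d) (LL d.+1)
  (@ins_at i d) (@ins_at_is_monoid_morphism i d).

Lemma coef_at_is_zmod_morphism i x d : zmod_morphism (@coef_at i x d).
Proof.
elim: d => [|d IH] f g /=; first exact: coefB.
case: eqP => _; first exact: (@coefB (LL d.+1)).
exact: Lmap_is_zmod_morphism.
Qed.

HB.instance Definition _ i x d := GRing.isZmodMorphism.Build (LL d.+1) (LL d)
  (@coef_at i x d) (@coef_at_is_zmod_morphism i x d).

(** Series free of the [i]-th variable are scalars for the extraction. This pulls out of a residue
    every factor that does not contain [u_1]. *)
Lemma coef_at_insM i x d (b : LL d) (f : LL d.+1) :
  coef_at i x (ins_at i b * f) = b * coef_at i x f.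
Proof.
elim: d b f => [|d IH] b f /=; first exact: (@coef_lcstM R).
case: eqP => _; first exact: (@coef_lcstM (LL d.+1)).
have Z := @ins_at_is_zmod_morphism i d; have Z' := @coef_at_is_zmod_morphism i x d.
have E (h : laurent (LL d)) : Lmap id h = h.
  by apply: laurentP => y; rewrite coef_Lmap.
have idB : zmod_morphism (@id (LL d)) by [].
by have := @LmapM _ _ _ (@coef_at i x d) (@ins_at i d) id Z' Z idB IH b f; rewrite E.
Qed.

Definition ins_exp (i : nat) (x : int) (e : nat -> int) : nat -> int :=
  fun k => if (k < i)%N then e k else if k == i then x else e k.-1.

Lemma mcoef_ins_at i d (f : LL d) (e : nat -> int) : (i <= d)%N ->
  mcoef (ins_at i f) e = if e i == 0 then mcoef f (e \o bump i) else 0.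
Proof.
elim: d f => [|d IH] f.
  by rewrite leqn0 => /eqP -> /=; rewrite coef_lcst.
rewrite leq_eqVlt => /predU1P[->|lti].
  rewrite /ins_at eqxx mcoef_lcst; case: eqP => // _.
  apply: eq_mcoef => k ltk /=.
  by rewrite /bump leqNgt ltk.
rewrite /ins_at ltn_eqF // -/(ins_at i) [LHS]/= coef_Lmap ?raddf0 //.
rewrite [LHS]IH; last by rewrite -ltnS.
by case: eqP => //= _; rewrite /bump -ltnS lti.
Qed.

Lemma mcoef_coef_at i x d (f : LL d.+1) e : (i <= d)%N ->
  mcoef (coef_at i x f) e = mcoef f (ins_exp i x e).
Proof.
elim: d f => [|d IH] f.
  by rewrite leqn0 => /eqP -> /=.
rewrite leq_eqVlt => /predU1P[->|lti].
  rewrite /coef_at eqxx [RHS]/= {1}/ins_exp ltnn eqxx -/mcoef.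
  by apply: (@eq_mcoef d.+1) => k ltk; rewrite /ins_exp ltk.
rewrite /coef_at ltn_eqF // -/(coef_at i) [LHS]/= coef_Lmap ?raddf0 //.
rewrite [LHS]IH; last by rewrite -ltnS.
rewrite [RHS]/= {2}/ins_exp ltnNge ltnW //= gtn_eqF //.
Qed.

(** * Variables, regularity in one variable, series with prescribed coefficients *)

Definition dec (i : nat) (e : nat -> int) : nat -> int :=
  fun k => if k == i then e k - 1 else e k.

Definition lvar (A : comPzRingType) : laurent A := mkL (fun e => (e == 1)%:R).

Fixpoint var (d i : nat) : LL d :=
  match d return LL d with
  | 0 => 0
  | d'.+1 => if d' == i then lvar (LL d')
             else lcst (var d' i)
  end.

Lemma coef_lvar (A : comPzRingType) (e : int) :
  coef (lvar A) e = (e == 1)%:R.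
Proof.
rewrite coef_mkL //; exists 0 => x xlt.
by rewrite (_ : (_ == _) = false) //; lia.
Qed.

Lemma coef_lvarM (A : comPzRingType) (f : laurent A) (e : int) :
  coef (lvar A * f) e = coef f (e - 1).
Proof.
rewrite (@coefM _ _ _ 1 (absz (Num.max 0 (e - lval f + 1))%R).+1).
- rewrite big_ord_recl big1 => [|i _]; last first.
    by rewrite lift0 coef_lvar (_ : (_ == _) = false) ?mul0r //; lia.
  by rewrite coef_lvar /= mul1r addr0; congr (coef _ _); lia.
- by move=> y ylt; rewrite coef_lvar lt_eqF.
- by move=> y Hy; apply: lvalP; lia.
Qed.

Lemma mcoef_varM d i (f : LL d) e : (i < d)%N ->
  mcoef (var d i * f) e = mcoef f (dec i e).
Proof.
elim: d f => [//|d IH] f lti /=.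
case: eqP => [E|/eqP ne].
  rewrite [coef _ _]coef_lvarM -E {1}/dec eqxx.
  by apply: eq_mcoef => k ltk; rewrite /dec ltn_eqF.
rewrite [coef _ _]coef_lcstM IH; last by rewrite ltn_neqAle eq_sym ne -ltnS.
by rewrite {2}/dec (negbTE ne).
Qed.

Lemma ins_at_var i d j : (i <= d)%N -> (j < d)%N ->
  ins_at i (var d j) = var d.+1 (bump i j).
Proof.
elim: d => [//|d IH].
rewrite leq_eqVlt => /predU1P[->|lti] ltj.
  have E : bump d.+1 j = j by rewrite /bump leqNgt ltj.
  by rewrite E /ins_at eqxx [RHS]/= -/(var d.+1 j) gtn_eqF.
rewrite /ins_at ltn_eqF // -/(ins_at i) [var d.+1.+1 _]/= -/(var d.+1 (bump i j)).
have i0 : @ins_at i d 0 = 0 by exact: raddf0.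
case: (eqVneq d j) => [E|ne] /=.
  rewrite E /bump -E -(ltnS i d) lti /= add1n eqxx; rewrite E eqxx.
  apply: laurentP => e; rewrite coef_Lmap ?raddf0 // !coef_lvar.
  by case: eqP => _; [exact: rmorph1|exact: raddf0].
rewrite (_ : (d.+1 == _) = false); last first.
  by apply/eqP; rewrite /bump; move: ne ltj lti; case: leqP; lia.
rewrite (negbTE ne) -/(var d.+1 (bump i j)) -IH //; last by lia.
by apply: laurentP => e; rewrite coef_Lmap // !coef_lcst; case: eqP.
Qed.

(** Poles in the other variables are allowed. For [i >= d] the exponent [e i] is invisible to
    [mcoef] and the condition would force [f = 0]; hence the bounds on [i] below. *)
Definition regular_at (i d : nat) (f : LL d) : Prop :=
  forall e : nat -> int, e i < 0 -> mcoef f e = 0.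

Lemma regular_atP i d (f : LL d.+1) : (i <= d)%N ->
  regular_at i f <-> forall x : int, x < 0 -> coef_at i x f = 0.
Proof.
move=> lei; split=> H => [x xlt|e elt].
  apply: mcoefP => e; rewrite mcoef_coef_at // mcoef0 H //.
  by rewrite /ins_exp ltnn eqxx.
have := congr1 (fun g => mcoef g (e \o bump i)) (H _ elt).
rewrite mcoef0 mcoef_coef_at // => <-.
apply: eq_mcoef => k _; rewrite /ins_exp /= /bump.
by case: ltngtP => [lt|lt|-> //]; congr e; rewrite /bump; lia.
Qed.

Lemma regular_atM i d (f g : LL d) : (i < d)%N ->
  regular_at i f -> regular_at i g -> regular_at i (f * g).
Proof.
elim: d f g => [//|d IH] f g lti Hf Hg e elt /=.
have HS (h : LL d.+1) : regular_at i h -> (d != i) ->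
    forall x, regular_at i (coef (h : laurent (LL d)) x).
  move=> Hh ne x e' elt'.
  have := Hh (fun k => if k == d then x else e' k).
  rewrite /= eqxx (eq_sym i d) (negbTE ne) => /(_ elt') <-.
  by apply: eq_mcoef => k ltk; rewrite ltn_eqF.
have HS' (h : LL d.+1) : regular_at i h -> (d = i) ->
    forall x, x < 0 -> coef (h : laurent (LL d)) x = 0.
  move=> Hh E x xlt; apply: mcoefP => e'.
  have := Hh (fun k => if k == d then x else e' k).
  rewrite /= eqxx -E eqxx mcoef0 => /(_ xlt) <-.
  by apply: eq_mcoef => k ltk; rewrite ltn_eqF.
case: (eqVneq d i) => [E|ne].
  rewrite (_ : coef _ _ = 0) ?mcoef0 //.
  (* At a negative exponent the window is empty: [f] starts at 0, and from there on [g] is read at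
     negative exponents only. *)
  rewrite (@coefM (LL d) f g 0 0%N) ?big_ord0 //; first exact: HS'.
  by move=> x Hx; apply: HS' => //; move: elt; rewrite -E; lia.
rewrite (@coefM (LL d) f g (lval (f : laurent (LL d))) (absz (Num.max 0 (e d - lval (f : laurent (LL d)) - lval (g : laurent (LL d)) + 1))%R)).
- rewrite mcoef_sum big1 // => k _; apply: IH => //; [by rewrite ltn_neqAle eq_sym ne -ltnS | exact: HS..].
- exact: lvalP.
- by move=> y Hy; apply: lvalP; lia.
Qed.

Definition upd (k : nat) (x : int) (e : nat -> int) : nat -> int :=
  fun j => if j == k then x else e j.

Definition trunc (d : nat) (e : nat -> int) : nat -> int :=
  fun k => if (k < d)%N then e k else 0.

(* Junk unless F is admissible. *)
Fixpoint mkLL (d : nat) (F : (nat -> int) -> R) : LL d :=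
  match d return LL d with
  | 0 => F (fun=> 0)
  | d'.+1 => (mkL (fun x => mkLL d' (fun e => F (upd d' x e))) : laurent (LL d'))
  end.

(** The bound on the outer exponent is uniform in the inner ones, while the bound on an inner
    exponent may depend on the outer ones, as in an iterated Laurent ring. *)
Fixpoint admissible (d : nat) (F : (nat -> int) -> R) : Prop :=
  match d with
  | 0 => True
  | d'.+1 => (exists v : int, forall x : int, x < v -> forall e, F (upd d' x e) = 0)
             /\ forall x, admissible d' (fun e => F (upd d' x e))
  end.

Lemma mkLL0 d F : (forall e, F e = 0) -> mkLL d F = 0.
Proof.
elim: d F => [|d IH] F H /=; first exact: H.
apply: laurentP => x; rewrite coef_mkL ?coef0; first exact: IH.
by exists 0 => y _; apply: IH.
Qed.

(** [mkLL] evaluates [F] only at exponents that vanish from [d] on, whence [trunc]. *)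
Lemma mcoef_mkLL d F e : admissible d F -> mcoef (mkLL d F) e = F (trunc d e).
Proof.
elim: d F => [|d IH] F /=; first by [].
move=> [[v Hv] Ha]; rewrite coef_mkL; last by exists v => x /Hv H; exact: mkLL0.
rewrite IH //; congr F; apply: funext => k; rewrite /upd /trunc.
by rewrite ltnS; case: (ltngtP k d) => // ->.
Qed.

Lemma admissible_nonneg d F :
  (forall e k, (k < d)%N -> e k < 0 -> F e = 0) -> admissible d F.
Proof.
elim: d F => [//|d IH] F H; split=> [|x].
  exists 0 => x xlt e; apply: (H _ d) => //.
  by rewrite /upd eqxx.
apply: IH => e k ltk elt; apply: (H _ k); first exact: ltnW.
by rewrite /upd ltn_eqF.
Qed.

End Iterated.

(** * Interpretation of the ring T d *)

Section PowerSeries.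
Variable A : comPzRingType.
Implicit Types (c d : nat -> A) (v w e : int).

Definition serL v c : laurent A := mkL (fun e => if v <= e then c (absz (e - v)) else 0).

Lemma coef_serL v c e : coef (serL v c) e = if v <= e then c (absz (e - v)) else 0.
Proof. by rewrite coef_mkL //; exists v => x xlt; rewrite leNgt xlt. Qed.

Lemma serLM v w c d : serL v c * serL w d = serL (v + w) (psmul c d).
Proof.
apply: laurentP => e; rewrite coef_serL; case: ifPn => [le|nle].
  rewrite (@coefM _ _ _ v (absz (e - (v + w))%R).+1).
  - apply: eq_bigr => i _; have := ltn_ord i; rewrite !coef_serL => lti.
    rewrite ifT ?lerDl // ifT; last by move: (nat_of_ord i) lti le => j; lia.
    by congr (c _ * d _); move: (nat_of_ord i) lti le => j; lia.
  - by move=> x xlt; rewrite coef_serL leNgt xlt.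
  - by move=> x Hx; rewrite coef_serL ifF //; lia.
rewrite (@coefM _ _ _ v 0%N) ?big_ord0 // => x Hx.
  by rewrite coef_serL leNgt Hx.
by rewrite coef_serL ifF //; lia.
Qed.

Lemma serL1 : serL 0 (fun k => (k == 0%N)%:R) = 1.
Proof.
apply: laurentP => e; rewrite coef_serL coef1 subr0 absz_eq0.
by case: ifPn => // le; case: eqP le => // ->.
Qed.

Lemma osumE (F : nat -> A) n : osum (opsR A) F n = \sum_(i < n) F i.
Proof. by rewrite -(big_mkord xpredT) unlock /= /index_iota subn0. Qed.

Lemma size_ginv_seq a0 c n : size (ginv_seq (opsR A) a0 c n) = n.+1.
Proof. by elim: n => //= n IH; rewrite size_rcons IH. Qed.

Lemma nth_ginv_seq a0 c n k : (k <= n)%N ->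
  nth 0 (ginv_seq (opsR A) a0 c n) k = ginv (opsR A) a0 c k.
Proof.
elim: n => [|n IH]; first by rewrite leqn0 => /eqP ->.
rewrite leq_eqVlt => /predU1P[->//|ltk].
by rewrite nth_rcons size_ginv_seq ltk IH // -ltnS.
Qed.

(** The recursion for an inverse series only adds and multiplies [- a0], [a0] and the [c i]. It
    serves to show that inverting a power series creates no negative powers. *)
Lemma ginv_ind (P : A -> Prop) a0 c :
  P 0 -> (forall x y, P x -> P y -> P (x + y)) -> (forall x y, P x -> P y -> P (x * y)) ->
  P (- a0) -> P a0 -> (forall i, P (c i)) -> forall k, P (ginv (opsR A) a0 c k).
Proof.
move=> P0 PD PM PN Pa Pc k.
suff H n i : P (nth 0 (ginv_seq (opsR A) a0 c n) i) by exact: H.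
elim: n i => [|n IH] i; first by case: i => [|[]].
rewrite nth_rcons; case: ifP => // _; case: ifP => // _.
apply: (PM) => //; rewrite osumE; elim/big_ind: _ => // j _.
exact: (PM).
Qed.

Lemma psmul_ginv a0 c : a0 * c 0%N = 1 ->
  psmul c (ginv (opsR A) a0 c) = fun k => (k == 0%N)%:R.
Proof.
move=> ac; apply: funext => -[|k]; rewrite /psmul.
  by rewrite big_ord_recl big_ord0 addr0 /= subn0 /ginv /= mulrC.
rewrite big_ord_recl /= subn0 {1}/ginv /= nth_rcons size_ginv_seq ltnn eqxx osumE.
rewrite mulrA mulrN (mulrC (c 0%N)) ac mulN1r addrC; apply/eqP; rewrite subr_eq0.
apply/eqP/eq_bigr => i _; rewrite /bump /= add1n subSS.
by rewrite nth_ginv_seq // leq_subr.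
Qed.

Lemma serL_inv v a0 c : a0 * c 0%N = 1 ->
  serL v c * serL (- v) (ginv (opsR A) a0 c) = 1.
Proof. by move=> ac; rewrite serLM subrr psmul_ginv // serL1. Qed.

End PowerSeries.

Section Interpretation.
Variable R : comPzRingType.
Local Notation LL := (LL R).
Local Notation T := (T R).
Local Notation opsT := (opsT R).

(** Forgets the choice of representatives, layer by layer; the operations of [opsT] become ring
    operations although [T d] is no ring. *)
Fixpoint phi (d : nat) : T d -> LL d :=
  match d return T d -> LL d with
  | 0 => fun f => f
  | d'.+1 => fun f => (mkL (fun x => phi (scoef (opsT d') f x)) : laurent (LL d'))
  end.

Lemma phi_o0 d : phi (o0 (opsT d)) = 0.
Proof.
elim: d => [//|d IH]; apply: laurentP => x; rewrite coef0 /= coef_mkL.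
  by rewrite /scoef; case: ifP.
by exists 0 => y _; rewrite /scoef; case: ifP.
Qed.

Lemma phi_ser d (v : int) (c : nat -> T d) :
  phi ((v, c) : T d.+1) = serL v (fun k => phi (c k)).
Proof.
rewrite /= /serL; congr mkL; apply: funext => x; rewrite /scoef /=.
by case: ifP => // _; rewrite phi_o0.
Qed.

Lemma coef_phi d (f : T d.+1) (x : int) :
  coef (phi f : laurent (LL d)) x = phi (scoef (opsT d) f x).
Proof.
rewrite [in LHS](surjective_pairing f) phi_ser coef_serL /scoef.
by case: ifP => // _; rewrite phi_o0.
Qed.

Lemma coefTE d (f : T d) e : coefT f e = mcoef (phi f) e.
Proof.
elim: d f => [//|d IH] f.
by rewrite [RHS]/= coef_phi -IH.
Qed.

Lemma phi_o1 d : phi (o1 (opsT d)) = 1.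
Proof.
elim: d => [//|d IH]; rewrite [o1 _]/= phi_ser -[RHS](serL1 (LL d)).
by congr serL; apply: funext => -[|k] /=; rewrite ?IH ?phi_o0.
Qed.

Lemma phi_add d (f g : T d) : phi (oadd (opsT d) f g) = phi f + phi g.
Proof.
elim: d f g => [//|d IH] f g; apply: laurentP => x; rewrite coefD !coef_phi -IH.
rewrite [in LHS]/scoef /=; case: ifPn => [le|nle].
  by congr (phi (oadd _ (scoef _ _ _) (scoef _ _ _))); lia.
rewrite /scoef; do 2![rewrite ifF; last by lia].
by rewrite IH phi_o0 addr0.
Qed.

Lemma phi_opp d (f : T d) : phi (oopp (opsT d) f) = - phi f.
Proof.
elim: d f => [//|d IH] f; apply: laurentP => x; rewrite coefN !coef_phi -IH /scoef /=.
by case: ifP => // _; rewrite IH phi_o0 oppr0.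
Qed.

Lemma phi_osum d F n : phi (osum (opsT d) F n) = \sum_(i < n) phi (F i).
Proof.
rewrite -(big_mkord xpredT (fun i => phi (F i))) /index_iota subn0 /osum.
elim: (iota 0 n) => [|i s IH] /=; first by rewrite big_nil phi_o0.
by rewrite big_cons phi_add IH.
Qed.

Lemma phi_mul d (f g : T d) : phi (omul (opsT d) f g) = phi f * phi g.
Proof.
elim: d f g => [//|d IH] [v f] [w g]; rewrite [omul _ _ _]/= !phi_ser serLM.
congr serL; apply: funext => k; rewrite phi_osum.
by apply: eq_bigr => i _; rewrite IH.
Qed.

Lemma phi_osumL (I : Type) d (s : seq I) (F : I -> T d) :
  phi (osumL (opsT d) [seq F i | i <- s]) = \sum_(i <- s) phi (F i).
Proof.
elim: s => [|i s IH]; first by rewrite big_nil phi_o0.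
by rewrite big_cons [osumL _ _]/= phi_add IH.
Qed.

Lemma phi_oprod (I : Type) d (s : seq I) (F : I -> T d) :
  phi (oprod (opsT d) [seq F i | i <- s]) = \prod_(i <- s) phi (F i).
Proof.
elim: s => [|i s IH]; first by rewrite big_nil phi_o1.
by rewrite big_cons [oprod _ _]/= phi_mul IH.
Qed.

Lemma phi_ginv d a0 (c : nat -> T d) k :
  phi (ginv (opsT d) a0 c k) = ginv (opsR (LL d)) (phi a0) (fun i => phi (c i)) k.
Proof.
have Hs n : size (ginv_seq (opsT d) a0 c n) = n.+1.
  by elim: n => //= n IH; rewrite size_rcons IH.
have H n i : phi (nth (o0 (opsT d)) (ginv_seq (opsT d) a0 c n) i) =
   nth 0 (ginv_seq (opsR (LL d)) (phi a0) (fun i => phi (c i)) n) i.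
  elim: n i => [|n IH] i; first by case: i => [|[]] //=; rewrite phi_o0.
  rewrite !nth_rcons Hs size_ginv_seq; case: ifP => // _.
  case: ifP => [_|_]; last exact: phi_o0.
  rewrite phi_mul phi_opp phi_osum osumE; congr (_ * _).
  by apply: eq_bigr => j _; rewrite phi_mul IH.
exact: H.
Qed.

Lemma phi_sinv d a0 (f : T d.+1) : phi a0 * phi (f.2 0%N) = 1 ->
  phi f * phi (sinv (opsT d) a0 f : T d.+1) = 1.
Proof.
case: f => v c H; rewrite /sinv !phi_ser.
rewrite [X in _ * serL _ X](_ : _ = ginv (opsR (LL d)) (phi a0) (fun i => phi (c i))).
  exact: serL_inv.
by apply: funext => k; exact: phi_ginv.
Qed.

Lemma phi_cst d (x : T d) : phi (cst (opsT d) x : T d.+1) = lcst (phi x).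
Proof.
rewrite /cst phi_ser; apply: laurentP => e; rewrite coef_serL coef_lcst subr0 absz_eq0.
by case: (ltgtP e 0) => // ?; rewrite ?phi_o0 //; case: eqP.
Qed.

Fixpoint liftLL (d : nat) : R -> LL d :=
  match d return R -> LL d with 0 => fun x => x | d'.+1 => fun x => lcst (liftLL d' x) end.

Lemma phi_liftR d x : phi (liftR d x) = liftLL d x.
Proof. by elim: d => [//|d IH]; rewrite phi_cst IH. Qed.

Lemma liftLL_is_zmod_morphism d : zmod_morphism (liftLL d).
Proof. by elim: d => [//|d IH] x y; rewrite /= IH; exact: raddfB. Qed.
Lemma liftLL_is_monoid_morphism d : monoid_morphism (liftLL d).
Proof.
elim: d => [//|d [IH1 IHM]]; split=> [|x y] /=; first by rewrite IH1; exact: rmorph1.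
by rewrite IHM; exact: rmorphM.
Qed.
HB.instance Definition _ d := GRing.isZmodMorphism.Build R (LL d) (liftLL d)
  (@liftLL_is_zmod_morphism d).
HB.instance Definition _ d := GRing.isMonoidMorphism.Build R (LL d) (liftLL d)
  (@liftLL_is_monoid_morphism d).

Lemma mcoef_liftLL d x e :
  mcoef (liftLL d x) e = if `[< forall k, (k < d)%N -> e k = 0 >] then x else 0.
Proof.
elim: d => [|d IH]; first by rewrite /= asboolT.
rewrite mcoef_lcst IH; case: eqP => [e0|ne].
  congr (if _ then _ else _); apply: asbool_equiv_eq; split=> H k.
    by rewrite ltnS leq_eqVlt => /predU1P[->//|]; exact: H.
  by move=> ltk; apply: H; exact: ltnW.
by rewrite asboolF // => /(_ d (ltnSn d)).
Qed.

Fixpoint plc (d be : nat) (B : forall k, LL k.+1) : LL d :=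
  match d return LL d with
  | 0 => 0
  | d'.+1 => if d' == be then B d' else lcst (plc d' be B)
  end.

Lemma phi_place d be (B : forall k, ser (T k)) :
  phi (place d be B) = plc d be (fun k => phi (B k : T k.+1)).
Proof.
elim: d => [//|d IH]; rewrite [place _ _ _]/= [plc _ _ _]/=.
by case: eqP => // _; rewrite phi_cst IH.
Qed.

Lemma plcM d be B C : (be < d)%N ->
  plc d be (fun k => B k * C k) = plc d be B * plc d be C.
Proof.
elim: d => [//|d IH] lt /=; case: eqVneq => // ne.
by rewrite IH; [exact: rmorphM | rewrite ltn_neqAle eq_sym ne -ltnS].
Qed.

Lemma plc1 d be B : (be < d)%N -> B be = 1 -> plc d be B = 1.
Proof.
elim: d => [//|d IH] lt B1 /=; case: eqVneq => [->//|ne].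
by rewrite IH //; [exact: rmorph1 | rewrite ltn_neqAle eq_sym ne -ltnS].
Qed.

Lemma mcoef_plc d be B e : (be < d)%N ->
  mcoef (plc d be B) e =
  if `[< forall k, (be < k < d)%N -> e k = 0 >] then mcoef (B be) e else 0.
Proof.
elim: d => [//|d IH] lt; rewrite [plc _ _ _]/=; case: eqVneq => [->|ne].
  by rewrite asboolT // => k /andP[]; rewrite ltnS ltnNge => /negP.
have lt' : (be < d)%N by rewrite ltn_neqAle eq_sym ne -ltnS.
rewrite mcoef_lcst IH //; case: eqP => [e0|ne0].
  congr (if _ then _ else _); apply: asbool_equiv_eq; split=> H k.
    rewrite ltnS => /andP[ltk]; rewrite leq_eqVlt => /predU1P[->//|lk].
    by apply: H; rewrite ltk.
  by move=> /andP[l1 l2]; apply: H; rewrite l1 ltnW.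
by rewrite asboolF // => /(_ d); rewrite lt' ltnSn => /(_ isT).
Qed.

Definition serVL (d al : nat) (v : int) (c : nat -> R) : LL d :=
  plc d al (fun k => serL v (fun i => liftLL k (c i))).

Lemma phi_serV d al v c : phi (serV d al v c) = serVL d al v c.
Proof.
rewrite /serV phi_place; congr plc; apply: functional_extensionality_dep => k.
rewrite phi_ser; congr serL; apply: funext => i; exact: phi_liftR.
Qed.

Lemma serVLM d al v w b c : (al < d)%N ->
  serVL d al v b * serVL d al w c = serVL d al (v + w) (psmul b c).
Proof.
move=> lt; rewrite /serVL -plcM //; congr plc; apply: functional_extensionality_dep => k.
rewrite serLM; congr serL; apply: funext => i; rewrite /psmul rmorph_sum.
by apply: eq_bigr => j _; rewrite rmorphM.
Qed.

Lemma serVL1 d al : (al < d)%N -> serVL d al 0 (fun k => (k == 0%N)%:R) = 1.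
Proof.
move=> lt; apply: plc1 => //; rewrite -[RHS](serL1 (LL al)); congr serL.
by apply: funext => k; rewrite rmorph_nat.
Qed.

Lemma mcoef_serVL d al (v : int) c e : (al < d)%N ->
  mcoef (serVL d al v c) e =
  if `[< forall k, (k < d)%N -> k <> al -> e k = 0 >] && (v <= e al)
  then c (absz (e al - v)) else 0.
Proof.
move=> lt; rewrite mcoef_plc // [mcoef _ _]/= coef_serL.
case: (asboolP (forall k, (k < d)%N -> _)) => [H|nH] /=; last first.
  case: asboolP => // H; case: ifP => // _; last exact: mcoef0.
  rewrite mcoef_liftLL asboolF // => H'; apply: nH => k ltk ne.
  by case: (ltngtP k al) => [/H'//|l|//]; apply: H; rewrite l.
rewrite asboolT; last by move=> k /andP[lk ltk]; apply: H => //; lia.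
case: ifP => _; last exact: mcoef0.
rewrite mcoef_liftLL asboolT // => k ltk; apply: H; lia.
Qed.

(** [fun k => h k.+1] is [h(z)/z]; its inverse times [z^-1] is [1/h(z)]. *)
Lemma serVL_inv d al (h : nat -> R) (b : R) : (al < d)%N -> h 0%N = 0 -> b * h 1%N = 1 ->
  serVL d al (-1) (psinv b (fun k => h k.+1)) * serVL d al 0 h = 1.
Proof.
move=> lt h0 hb; rewrite serVLM // ?addr0.
have -> : psmul (psinv b (fun k => h k.+1)) h = fun k => (k == 1%N)%:R.
  apply: funext => -[|k]; rewrite /psmul.
    by rewrite big_ord_recl big_ord0 /= h0 mulr0 addr0.
  rewrite big_ord_recr /= subnn h0 mulr0 addr0.
  transitivity (psmul (fun k => h k.+1) (psinv b (fun k => h k.+1)) k).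
    rewrite /psmul (reindex_inj rev_ord_inj) /=; apply: eq_bigr => i _.
    have := ltn_ord i; rewrite mulrC => lti.
    by congr (h _ * psinv _ _ _); lia.
  by rewrite (psmul_ginv (c := fun k => h k.+1)) //.
apply: plc1 => //; apply: laurentP => e; rewrite coef_serL coef1 rmorph_nat.
case: ifP => H; first by congr (_%:R); congr nat_of_bool; lia.
by rewrite (_ : (e == 0) = false) //; lia.
Qed.

Definition FioLL (k : nat) (cc : nat -> nat -> R) (al : nat) (h g : nat -> R)
    : laurent (LL k) :=
  serL 0 (fun m => \sum_(l < m.+1)
     liftLL k (pspow g l m) * serVL k al 0 (pscomp (fun i => cc i l) h)).

Lemma phi_FioL k cc al h g : phi (FioL k cc al h g : T k.+1) = FioLL k cc al h g.
Proof.
rewrite /FioL phi_ser; congr serL; apply: funext => m; rewrite phi_osum.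
by apply: eq_bigr => l _; rewrite phi_mul phi_liftR phi_serV.
Qed.

Lemma pscomp_lin (f h : nat -> R) : (forall k, f k = (k == 1%N)%:R) -> h 0%N = 0 ->
  pscomp f h = h.
Proof.
move=> f1 h0; apply: funext => -[|m]; rewrite /pscomp.
  by rewrite big_ord_recl big_ord0 f1 mul0r addr0 h0.
rewrite 2!big_ord_recl big1 => [|i _]; last by rewrite f1 mul0r.
rewrite !f1 mul0r add0r mul1r addr0 /= /psmul big_ord_recr /= subnn mulr1 big1 ?add0r //.
move=> i _; rewrite (_ : (_ == _) = false) ?mulr0 //.
by apply/negbTE; rewrite subn_eq0 -ltnNge.
Qed.

(** The coefficient at exponent 0 of the outer variable is [F(h(y_al), 0) = h(y_al)], which
    [serVL_inv] inverts. *)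
Lemma FioL_inv k cc al h g b : (al < k)%N -> (forall i, cc i 0%N = (i == 1%N)%:R) ->
  h 0%N = 0 -> b * h 1%N = 1 ->
  phi (FioL k cc al h g : T k.+1) *
  phi (sinv (opsT k) (serV k al (-1) (psinv b (fun k => h k.+1))) (FioL k cc al h g)
       : T k.+1) = 1.
Proof.
move=> lt c1 h0 hb; apply: phi_sinv; rewrite phi_serV [_.2]/= phi_osum big_ord_recl big_ord0.
rewrite addr0 phi_mul phi_liftR /= rmorph1 mul1r phi_serV pscomp_lin //.
exact: serVL_inv.
Qed.

Lemma Fsub_inv a d al h be g b b' : (al < d)%N -> (be < d)%N -> al <> be ->
  h 0%N = 0 -> b * h 1%N = 1 -> g 0%N = 0 -> b' * g 1%N = 1 ->
  phi (Fsub a d al h be g) *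
  phi (Fsubinv a d al h (psinv b (fun k => h k.+1)) be g (psinv b' (fun k => g k.+1))) = 1.
Proof.
move=> lta ltb ne h0 hb g0 gb; rewrite /Fsub /Fsubinv; case: ifPn => [lt|nlt].
  rewrite !phi_place -plcM // plc1 //; apply: FioL_inv => // i.
  by rewrite /fglc; case: i.
rewrite !phi_place -plcM // plc1 //; apply: FioL_inv => //; first by lia.
Qed.

End Interpretation.

(** * Setting one variable equal to another *)

Section Evaluation.
Variable R : comPzRingType.
Local Notation LL := (LL R).

Lemma mcoef1 d e : mcoef (1 : LL d) e = (`[< forall k, (k < d)%N -> e k = 0 >])%:R.
Proof. by rewrite -(rmorph1 (@liftLL R d)) mcoef_liftLL; case: ifP. Qed.

Lemma mcoef_liftLLM d x (f : LL d) e : mcoef (liftLL d x * f) e = x * mcoef f e.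
Proof. by elim: d f => [//|d IH] f /=; rewrite -IH; congr mcoef; exact: coef_lcstM. Qed.

Lemma regular_atD i d (f g : LL d) :
  regular_at i f -> regular_at i g -> regular_at i (f + g).
Proof. by move=> Hf Hg e elt; rewrite mcoefD Hf ?Hg ?addr0. Qed.

Lemma regular_atB i d (f g : LL d) :
  regular_at i f -> regular_at i g -> regular_at i (f - g).
Proof. by move=> Hf Hg e elt; rewrite mcoefB Hf ?Hg ?subr0. Qed.

Lemma regular_at_ins i d (b : LL d) : (i <= d)%N -> regular_at i (ins_at i b).
Proof. by move=> lei e elt; rewrite mcoef_ins_at // lt_eqF. Qed.

Lemma regular_at1 i d : (i < d)%N -> regular_at i (1 : LL d).
Proof. by move=> lti e elt; rewrite mcoef1 asboolF // => /(_ i lti); lia. Qed.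

Lemma regular_at_var i j d : (i < d)%N -> (j < d)%N -> regular_at i (var R d j).
Proof.
move=> lti ltj e elt; rewrite -[var R d j]mulr1 mcoef_varM // mcoef1 asboolF //.
by move=> /(_ i lti); rewrite /dec; case: eqP => _; lia.
Qed.

(* sim i x f b reads: f has no negative power of the i-th variable, and b is
   the value of f at the i-th variable equal to x. *)
Definition sim i d (x : LL d) (f : LL d.+1) (b : LL d) : Prop :=
  exists2 g, regular_at i g & f = ins_at i b + (var R d.+1 i - ins_at i x) * g.

Section Sim.
Variables (i d : nat) (x : LL d).
Hypothesis lei : (i <= d)%N.

Lemma sim_regular f b : sim i x f b -> regular_at i f.
Proof.
move=> [g Hg ->]; apply: regular_atD; first exact: regular_at_ins.
by apply: regular_atM => //; apply: regular_atB; [apply: regular_at_var | apply: regular_at_ins].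
Qed.

Lemma sim_ins b : sim i x (ins_at i b) b.
Proof. by exists 0; [move=> e _; exact: mcoef0 | rewrite mulr0 addr0]. Qed.

Lemma simM f b f' b' : sim i x f b -> sim i x f' b' -> sim i x (f * f') (b * b').
Proof.
move=> [g Hg Ef] Sf'; have Hf' := sim_regular Sf'; case: Sf' => g' Hg' Ef'.
exists (g * f' + ins_at i b * g').
  apply: regular_atD; apply: regular_atM => //; exact: regular_at_ins.
by rewrite rmorphM Ef {1}Ef' Ef'; ring.
Qed.

Lemma sim_prod (I : eqType) (r : seq I) (P : pred I) F G :
  (forall k, k \in r -> P k -> sim i x (F k) (G k)) ->
  sim i x (\prod_(k <- r | P k) F k) (\prod_(k <- r | P k) G k).
Proof.
move=> H; rewrite big_seq_cond [X in sim _ _ _ X]big_seq_cond.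
elim/big_rec2: _ => [|k b f /andP[kr Pk] S]; last exact: simM (H _ kr Pk) S.
by rewrite -(rmorph1 (@ins_at R i d)); exact: sim_ins.
Qed.

(** Up to [ins_at], [f' - b' = - f' b' (f - b)], and [f - b] is a multiple of [u - x]. Regularity of
    [f'] is a genuine condition: [u + y] is regular in [u], but its inverse expanded in [y] has
    negative powers of [u]. *)
Lemma sim_inv f b f' b' : sim i x f b -> regular_at i f' ->
  f * f' = 1 -> b * b' = 1 -> sim i x f' b'.
Proof.
move=> [g Hg Ef] Hf' E E'; exists (- (f' * ins_at i b' * g)).
  rewrite -sub0r; apply: regular_atB; first by move=> e _; exact: mcoef0.
  by do 2![apply: regular_atM => //]; exact: regular_at_ins.
have Eb : ins_at i b * ins_at i b' = 1 by rewrite -rmorphM E' rmorph1.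
have -> : (var R d.+1 i - ins_at i x) * - (f' * ins_at i b' * g) =
   - (f' * ins_at i b') * (f - ins_at i b) by rewrite Ef; ring.
have -> : - (f' * ins_at i b') * (f - ins_at i b) =
   - (f * f') * ins_at i b' + f' * (ins_at i b * ins_at i b') by ring.
by rewrite E Eb; ring.
Qed.

(** Residue at a simple pole: with [q = 1/(u - x)], the product [f * q] is [b * q] plus a series
    without negative powers of [u]. *)
Lemma coef_at_sim f b q (m : int) : sim i x f b -> m < 0 ->
  q * (var R d.+1 i - ins_at i x) = 1 -> coef_at i m (f * q) = b * coef_at i m q.
Proof.
move=> [g Hg ->] mlt E.
have -> : (ins_at i b + (var R d.+1 i - ins_at i x) * g) * q =
  ins_at i b * q + (q * (var R d.+1 i - ins_at i x)) * g by ring.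
rewrite E mul1r (raddfD (@coef_at R i m d)) [X in X + _]coef_at_insM [X in _ + X](_ : _ = 0) ?addr0 //.
by have /regular_atP := Hg; apply.
Qed.

End Sim.

Definition power d (f : LL d) : Prop := forall i, (i < d)%N -> regular_at i f.

(** The coefficients in the outer variable are power series; the constant one is inverted by
    induction, and [ginv_ind] shows that the recursion for the others stays among power series. *)
Lemma power_inv d (f : LL d) : power f -> mcoef f (fun=> 0) = 1 ->
  exists2 g, power g & f * g = 1.
Proof.
elim: d f => [|d IH] f Hf f1; first by exists 1 => //; rewrite mulr1.
pose c k := coef (f : laurent (LL d)) k%:Z.
have Hc (x : int) : power (coef (f : laurent (LL d)) x).
  move=> i lti e elt; pose e' := upd d x e.
  have -> : mcoef (coef (f : laurent (LL d)) x) e = mcoef f e'.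
    have Ed : e' d = x by rewrite /e' /upd eqxx.
    rewrite /= Ed; apply: eq_mcoef => k ltk.
    by rewrite /e' /upd ltn_eqF.
  by apply: (Hf i); [exact: ltnW | rewrite /e' /upd ltn_eqF].
have Hneg (x : int) : x < 0 -> coef (f : laurent (LL d)) x = 0.
  move=> xlt; apply: mcoefP => e; rewrite mcoef0.
  have <- : mcoef f (upd d x e) = 0 by apply: (Hf d) => //; rewrite /upd eqxx.
  have Ed : upd d x e d = x by rewrite /upd eqxx.
  rewrite /= Ed; apply: eq_mcoef => k ltk.
  by rewrite /upd ltn_eqF.
have [b Hb cb] := IH (c 0%N) (Hc _) f1.
have Ef : f = serL 0 c.
  apply: laurentP => x; rewrite coef_serL subr0 /c; case: ifPn => H; last first.
    by apply: Hneg; rewrite ltNge.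
  by rewrite gez0_abs.
have Hg k : power (ginv (opsR (LL d)) b c k).
  move=> i lti; apply: ginv_ind; rewrite /c.
  - by move=> e _; exact: mcoef0.
  - by move=> u v; exact: regular_atD.
  - by move=> u v; exact: regular_atM.
  - by rewrite -sub0r; apply: regular_atB; [move=> e _; exact: mcoef0 | exact: Hb].
  - exact: Hb.
  - by move=> k'; exact: Hc.
exists (serL 0 (ginv (opsR (LL d)) b c)).
  move=> i lti e elt /=; rewrite coef_serL subr0.
  case: ifP => H; last exact: mcoef0.
  apply: (Hg _ i) => //; rewrite ltn_neqAle -ltnS lti andbT.
  by apply/eqP => E; move: elt; rewrite E ltNge H.
by rewrite {1}Ef -[0 in X in _ * X]oppr0; apply: serL_inv; rewrite mulrC.
Qed.

#[local] Arguments mcoef R d f e : simpl never.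

(* The quotient in sim is the divided difference of f. *)
Lemma sim_power i j d (f : LL d.+1) (b : LL d) : (i <= d)%N -> (j < d)%N -> power f ->
  (forall e, mcoef b e = if 0 <= e j then
     \sum_(t < (absz (e j)).+1) mcoef f (ins_exp i t%:Z (upd j (e j - t%:Z) e))
     else 0) ->
  sim i (var R d j) f b.
Proof.
move=> lei ltj Hf Hb; pose J := bump i j.
have neJ : (J == i) = false by rewrite /J /bump; apply/eqP; case: leqP; lia.
have ltJ : (J < d.+1)%N by rewrite /J /bump; case: leqP; lia.
(* [F] holds the coefficients of [(f(u) - f(x))/(u - x)], read off from [(u^m - x^m)/(u - x)], the
   sum of the [u^p x^q] with [p + q = m - 1]. The shift [sh s t] raises the exponent of [u] by [s]
   and lowers that of [x] by [t]. *)
pose sh s t (e : nat -> int) k : int :=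
  if k == i then e i + s%:Z else if k == J then e J - t%:Z else e k.
pose F (e : nat -> int) := if (0 <= e i) && (0 <= e J) then
  \sum_(t < (absz (e J)).+1) mcoef f (sh t.+1 t e) else 0.
have sh_eq (e e' : nat -> int) s t : (forall k, (k < d.+1)%N -> e k = e' k) ->
    mcoef f (sh s t e) = mcoef f (sh s t e').
  move=> H; apply: eq_mcoef => k ltk; rewrite /sh !H //.
have Fpos e k : (k < d.+1)%N -> e k < 0 -> F e = 0.
  move=> ltk elt; rewrite /F; case: ifP => // /andP[pi pJ].
  apply: big1 => t _; apply: (Hf k) => //; rewrite /sh.
  case: eqP => [Ek|_]; first by rewrite Ek in elt; lia.
  by case: eqP => // Ek; rewrite Ek in elt; lia.
have cG e : mcoef (mkLL d.+1 F) e = F e.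
  rewrite mcoef_mkLL; last exact: admissible_nonneg.
  have trE k : (k < d.+1)%N -> trunc d.+1 e k = e k by rewrite /trunc => ->.
  rewrite /F !trE //; case: ifP => // _; apply: eq_bigr => t _; exact: sh_eq.
exists (mkLL d.+1 F).
  by move=> e elt; rewrite cG (Fpos e i).
apply: mcoefP => e; rewrite ins_at_var // mcoefD mulrBl mcoefB !mcoef_varM // !cG.
rewrite mcoef_ins_at // Hb.
have -> : (e \o bump i) j = e J by [].
have EJ : dec i e J = e J by rewrite /dec neJ.
have Ei : dec J e i = e i by rewrite /dec eq_sym neJ.
have EJJ : dec J e J = e J - 1 by rewrite /dec eqxx.
have Eii : dec i e i = e i - 1 by rewrite /dec eqxx.
case: (ltP (e J) 0) => eJ.
  rewrite (Hf J) // (Fpos _ J) ?EJ // (Fpos _ J) ?EJJ //; last by lia.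
  by case: eqP; rewrite subrr addr0.
case: (ltP (e i) 0) => ei.
  by rewrite (Hf i) // !(Fpos _ i) ?Eii ?Ei //; [rewrite lt_eqF // subrr addr0 | lia].
have FJ : F (dec J e) = \sum_(t < absz (e J)) mcoef f (sh t.+1 t.+1 e).
  rewrite /F Ei EJJ ei /=; case: ifP => le1; last first.
    by rewrite (_ : absz (e J) = 0%N) ?big_ord0 //; lia.
  rewrite (_ : (absz (e J - 1)).+1 = absz (e J)); last by lia.
  apply: eq_bigr => t _; apply: eq_mcoef => k _; rewrite /sh EJJ Ei /dec.
  by case: eqP => // _; case: eqP => // _; lia.
have sh0 : mcoef f (sh 0%N 0%N e) = mcoef f e.
  apply: eq_mcoef => k _; rewrite /sh subr0 addr0.
  by case: eqP => [->//|_]; case: eqP => [->//|].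
have shE t k : e i = 0 ->
    ins_exp i t%:Z (upd j (e J - t%:Z) (e \o bump i)) k = sh t t e k.
  rewrite /ins_exp /upd /sh /= => ->; case: (ltngtP k i) => [lt|lt|_]; last by rewrite add0r.
    rewrite (_ : (k == J) = (k == j)); last by rewrite /J /bump; lia.
    by case: eqP => // _; congr e; rewrite /bump; lia.
  rewrite (_ : (k == J) = (k.-1 == j)); last by rewrite /J /bump; lia.
  by case: eqP => // _; congr e; rewrite /bump; lia.
(* For [e i = 0] multiplication by [u] contributes nothing, and the terms [t > 0] of [b] cancel the
   sum coming from [x]. Otherwise the two sums telescope to the term [t = 0], the coefficient of [f]
   itself. *)
rewrite FJ; case: eqP => [ei0|nei].
  rewrite /F Eii ei0 /= sub0r; apply/eqP; rewrite -subr_eq opprK; apply/eqP.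
  rewrite -sh0 [RHS]big_ord_recl; congr (_ + _).
    by apply: eq_mcoef => k _; rewrite -shE.
  by apply: eq_bigr => t _; apply: eq_mcoef => k _; rewrite shE // lift0.
rewrite add0r /F Eii EJ eJ (_ : 0 <= e i - 1); last by lia.
rewrite /= big_ord_recl -addrA [X in _ + X](_ : _ = 0) ?addr0; last first.
  apply/eqP; rewrite subr_eq0; apply/eqP/eq_bigr => t _; apply: eq_mcoef => k _.
  by rewrite /sh Eii EJ lift0 /dec; case: (k == i) => //; lia.
rewrite -sh0; apply: eq_mcoef => k _; rewrite /sh Eii EJ /dec /=.
by case: (k == i); rewrite ?subrK ?addr0.
Qed.

End Evaluation.

(** * Power series in two variables *)

Section Bivariate.
Variable R : comPzRingType.
Local Notation LL := (LL R).
Implicit Types (F : nat -> nat -> R) (e : nat -> int).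
Implicit Types c : nat -> R.
#[local] Arguments mcoef R d f e : simpl never.

Definition others (d al be : nat) e : bool :=
  `[< forall k, (k < d)%N -> k <> al -> k <> be -> e k = 0 >].

Definition bicoef (d al be : nat) F e : R :=
  if [&& others d al be e, 0 <= e al & 0 <= e be] then F (absz (e al)) (absz (e be)) else 0.

(* The power series F(y_al, y_be). *)
Definition biser (d al be : nat) F : LL d := mkLL d (bicoef d al be F).

Lemma mcoef_biser d al be F e : (al < d)%N -> (be < d)%N ->
  mcoef (biser d al be F) e = bicoef d al be F e.
Proof.
move=> lta ltb; rewrite mcoef_mkLL.
  rewrite /bicoef /trunc lta ltb; congr (if _ && _ then _ else _).
  by apply: asbool_equiv_eq; split=> H k ltk; have := H k ltk; rewrite ltk.
apply: admissible_nonneg => e' k ltk elt; rewrite /bicoef; case: ifP => // /and3P[/asboolP H].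
case: (eqVneq k al) => [<-|/eqP na]; first by rewrite leNgt elt.
case: (eqVneq k be) => [<-|/eqP nb]; first by move=> _; rewrite leNgt elt.
by move: elt; rewrite (H k ltk na nb).
Qed.

Lemma power_biser d al be F : (al < d)%N -> (be < d)%N -> power (biser d al be F).
Proof.
move=> lta ltb k ltk e elt; rewrite mcoef_biser // /bicoef; case: ifP => // /and3P[/asboolP H].
case: (eqVneq k al) => [<-|/eqP na]; first by rewrite leNgt elt.
case: (eqVneq k be) => [<-|/eqP nb]; first by move=> _; rewrite leNgt elt.
by move: elt; rewrite (H k ltk na nb).
Qed.

Lemma biserC d al be F : biser d al be F = biser d be al (fun p q => F q p).
Proof.
congr mkLL; apply: funext => e; rewrite /bicoef [in RHS](andbC (0 <= _)).
congr (if _ && _ then _ else _).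
by apply: asbool_equiv_eq; split=> H k ltk n1 n2; apply: H.
Qed.

Lemma mcoef_ser d al c e : (al < d)%N -> mcoef (serVL d al 0 c : LL d) e =
  if others d al al e && (0 <= e al) then c (absz (e al)) else 0.
Proof.
move=> lt; rewrite mcoef_serVL // subr0; congr (if _ && _ then _ else _).
apply: asbool_equiv_eq; split=> H k ltk n1; last exact: H.
by move=> _; exact: H.
Qed.

Lemma ser_biser d al be c : (al < d)%N -> (be < d)%N -> al <> be ->
  serVL d al 0 c = biser d al be (fun p q => c p * (q == 0%N)%:R).
Proof.
move=> lta ltb ne; apply: mcoefP => e; rewrite mcoef_ser // mcoef_biser // /bicoef.
case: (eqVneq (e be) 0) => [e0|ne0].
  rewrite e0 lexx andbT mulr1; congr (if _ && _ then _ else _).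
  apply: asbool_equiv_eq; split=> H k ltk n1 n2; first exact: H.
  by case: (k =P be) => [->//|nb]; exact: H.
rewrite absz_eq0 (negbTE ne0) mulr0 if_same; case: ifP => // /andP[/asboolP H _].
by move: ne0; rewrite (H be) ?eqxx // => E; case: ne.
Qed.

Lemma bump_ltS i j d : (i <= d)%N -> (j < d)%N -> (bump i j < d.+1)%N.
Proof. by rewrite /bump; case: leqP; lia. Qed.

Lemma others_bump d i al be e : (i <= d)%N -> e i = 0 ->
  others d.+1 (bump i al) (bump i be) e = others d al be (e \o bump i).
Proof.
move=> lei ei; apply: asbool_equiv_eq; split=> H k ltk n1 n2 /=.
  by apply: H; [exact: bump_ltS | move/(can_inj (bumpK i)) ..].
case: (k =P i) => [->//|/eqP nk]; have E := unbumpK nk.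
rewrite -E; apply: H; last 2 first; try by move=> E'; move: n1 n2; rewrite -E E'.
by move: ltk nk lei; rewrite /unbump; case: ltnP; lia.
Qed.

Lemma others_ins d i be e : (i <= d)%N ->
  others d.+1 i (bump i be) e = others d be be (e \o bump i).
Proof.
move=> lei; apply: asbool_equiv_eq; split=> H k ltk n1 n2 /=.
  apply: H; first exact: bump_ltS; last by move/(can_inj (bumpK i)).
  by apply/eqP; rewrite eq_sym neq_bump.
have /eqP nk := n1; have E := unbumpK nk.
rewrite -E; apply: H; last 2 first; try by move=> E'; move: n2; rewrite -E E'.
by move: ltk nk lei; rewrite /unbump; case: ltnP; lia.
Qed.

Lemma ins_exp_bump i x e : ins_exp i x e \o bump i = e.
Proof.
apply: funext => k; rewrite /ins_exp /bump /=.
case: (leqP i k) => l; rewrite ?add1n ?add0n; last by rewrite l.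
by rewrite ltnNge leqW //= gtn_eqF.
Qed.

Lemma ins_exp_bumpE i x e k : ins_exp i x e (bump i k) = e k.
Proof. exact: (congr1 (fun g => g k) (ins_exp_bump i x e)). Qed.

Lemma ins_expE i x e : ins_exp i x e i = x.
Proof. by rewrite /ins_exp ltnn eqxx. Qed.

Lemma ins_at_biser i d al be F : (i <= d)%N -> (al < d)%N -> (be < d)%N ->
  ins_at i (biser d al be F) = biser d.+1 (bump i al) (bump i be) F.
Proof.
move=> lei lta ltb; apply: mcoefP => e; rewrite mcoef_ins_at //.
rewrite [RHS]mcoef_biser ?bump_ltS // /bicoef; case: eqP => [e0|ne].
  by rewrite mcoef_biser // /bicoef others_bump.
case: ifP => // /andP[/asboolP H _]; case: ne; apply: H => //.
  by apply/eqP; rewrite neq_bump.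
by apply/eqP; rewrite neq_bump.
Qed.

Lemma ins_at_ser i d al c : (i <= d)%N -> (al < d)%N ->
  ins_at i (serVL d al 0 c) = serVL d.+1 (bump i al) 0 c.
Proof.
move=> lei lta; apply: mcoefP => e; rewrite mcoef_ins_at //.
rewrite [RHS]mcoef_ser ?bump_ltS //; case: eqP => [e0|ne].
  by rewrite mcoef_ser // others_bump.
case: ifP => // /andP[/asboolP H _]; case: ne; apply: H => //;
  by apply/eqP; rewrite neq_bump.
Qed.

Lemma sim_biser i d j be F : (i <= d)%N -> (j < d)%N -> (be < d)%N -> be <> j ->
  sim i (var R d j) (biser d.+1 i (bump i be) F) (biser d j be F).
Proof.
move=> lei ltj ltb ne; have ltB := bump_ltS lei ltb.
apply: sim_power => //; first exact: power_biser.
move=> e; rewrite mcoef_biser // /bicoef; case: (leP 0 (e j)) => ej; last by rewrite andbF.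
have E (t : nat) : mcoef (biser d.+1 i (bump i be) F) (ins_exp i t%:Z (upd j (e j - t%:Z) e)) =
    if others d be be (upd j (e j - t%:Z) e) && (0 <= e be) then F t (absz (e be)) else 0.
  rewrite mcoef_biser // /bicoef others_ins // ins_exp_bump ins_expE ins_exp_bumpE.
  by rewrite {2 3}/upd; have /eqP/negbTE -> := ne.
(* The series does not involve the [j]-th variable, so only the term that uses up its whole
   exponent, [t = e j], survives. *)
rewrite big_ord_recr big1 => [|t _] /=; last first.
  rewrite E (_ : others _ _ _ _ = false) //; apply: asboolF => /(_ j ltj).
  rewrite /upd eqxx => H; have : e j - t%:Z = 0 by apply: H => E'; case: ne.
  by have := ltn_ord t; lia.
rewrite E add0r gez0_abs // subrr; congr (if _ && _ then _ else _).
apply: asbool_equiv_eq; split=> H k ltk n1 n2.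
  by rewrite /upd; case: eqP => // nkj; apply: H.
by have := H k ltk n2 n2; rewrite /upd; case: eqP.
Qed.

Lemma sim_biser_diag i d j F : (i <= d)%N -> (j < d)%N ->
  sim i (var R d j) (biser d.+1 i (bump i j) F)
    (serVL d j 0 (fun m => \sum_(p < m.+1) F p (m - p)%N)).
Proof.
move=> lei ltj; have ltB := bump_ltS lei ltj.
apply: sim_power => //; first exact: power_biser.
move=> e; rewrite mcoef_ser //; case: (leP 0 (e j)) => ej; last by rewrite andbF.
rewrite andbT; transitivity (\sum_(t < (absz (e j)).+1)
    if others d j j e then F t (absz (e j) - t)%N else 0).
  by case: ifP => // _; rewrite big1.
apply: eq_bigr => t _.
rewrite mcoef_biser // /bicoef others_ins // ins_exp_bump ins_expE ins_exp_bumpE.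
have -> : others d j j (upd j (e j - t%:Z) e) = others d j j e.
  by apply: asbool_equiv_eq; split=> H k ltk n1 n2; have := H k ltk n1 n2;
     rewrite /upd; case: eqP.
have := ltn_ord t; rewrite ltnS => let_.
rewrite /upd eqxx (_ : 0 <= e j - t%:Z); last by lia.
by rewrite !andbT; case: ifP => // _; congr F; lia.
Qed.

Lemma sim_ser i d j c : (i <= d)%N -> (j < d)%N ->
  sim i (var R d j) (serVL d.+1 i 0 c) (serVL d j 0 c).
Proof.
move=> lei ltj; have ltB := bump_ltS lei ltj.
rewrite (@ser_biser d.+1 i (bump i j)) //; last by apply/eqP; rewrite neq_bump.
rewrite (_ : serVL d j 0 c = serVL d j 0
   (fun m => \sum_(p < m.+1) c p * ((m - p)%N == 0%N)%:R)); first exact: sim_biser_diag.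
congr serVL; apply: funext => m; rewrite big_ord_recr /= subnn mulr1 big1 ?add0r // => p _.
by rewrite subn_eq0 leqNgt ltn_ord mulr0.
Qed.

(** Coefficients of [F(u,v)/(u - v)] when [F(v,v) = 0]: the recurrence
    [G (p-1) q - G p (q-1) = F p q] solved along an antidiagonal. *)
Definition divdiff F p q : R := \sum_(t < q.+1) F (p + t.+1)%N (q - t)%N.

Lemma biser_divdiff d al be F : (al < d)%N -> (be < d)%N -> al <> be ->
  (forall m, \sum_(p < m.+1) F p (m - p)%N = 0) ->
  biser d al be F = (var R d al - var R d be) * biser d al be (divdiff F).
Proof.
move=> lta ltb ne diag; have /eqP/negbTE nab := ne; have nba := nab; rewrite eq_sym in nba.
apply: mcoefP => e; rewrite mulrBl mcoefB !mcoef_varM // !mcoef_biser // /bicoef.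
have od k : (k == al) || (k == be) -> others d al be (dec k e) = others d al be e.
  move=> Hk; apply: asbool_equiv_eq; split=> H l ltl n1 n2; have := H l ltl n1 n2;
    by rewrite /dec; case: eqP => // E; move: Hk; rewrite -E => /orP[]/eqP.
rewrite !od ?eqxx ?orbT // /dec !eqxx nab nba.
case: (others d al be e) => /=; last by rewrite subrr.
case: (leP 0 (e al)) => ha; last first.
  by rewrite (_ : (0 <= e al - 1) = false) ?subrr //; lia.
case: (leP 0 (e be)) => hb; last first.
  by rewrite !andbF (_ : (0 <= e be - 1) = false) ?andbF ?subrr //; lia.
move: ha hb; case: (e al) => // p _; case: (e be) => // q _.
have N0 : (0 <= 0%:Z - 1 :> int) = false by [].
have N1 k : k.+1%:Z - 1 = k by lia.
have P0 k : (0 <= k%:Z :> int) by [].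
case: p q => [|p] [|q]; rewrite ?N0 ?N1 ?P0 ?andbF ?andbT ?andTb ?andFb ?subrr ?sub0r ?subr0 /=.
- by have := diag 0%N; rewrite big_ord1.
(* On the edge [p = 0] there is no term from [u]; the vanishing of the antidiagonal sum gives the
   recurrence there. *)
- have := diag q.+1; rewrite big_ord_recl subn0 => /eqP; rewrite addr_eq0 => /eqP ->.
  by congr (- _); apply: eq_bigr => t _; rewrite lift0 subSS.
- by rewrite /divdiff big_ord1 addn1.
rewrite /divdiff big_ord_recl addn1 subn0 -addrA [X in _ + X](_ : _ = 0) ?addr0 //.
apply/eqP; rewrite subr_eq0; apply/eqP/eq_bigr => t _.
by rewrite lift0 subSS addSnnS.
Qed.

Lemma biser_inv d al be F : (al < d)%N -> (be < d)%N -> F 0%N 0%N = 1 ->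
  exists2 g, power g & biser d al be F * g = 1.
Proof.
move=> lta ltb F1; apply: power_inv; first exact: power_biser.
rewrite mcoef_biser // /bicoef ifT //= andbT; exact: asboolT.
Qed.

(* 1/(u - x) = x^0 u^-1 + x^1 u^-2 + ..., with u of lower level than x. *)
Lemma geometric i j d : (i <= j)%N -> (j < d)%N ->
  exists2 q : LL d.+1, q * (var R d.+1 i - var R d.+1 j.+1) = 1 &
    forall m, coef_at i (- m.+1%:Z) q = serVL d j 0 (fun k => (k == m)%:R).
Proof.
move=> leij ltj; have lti : (i < j.+1)%N by []; have lti' : (i < d.+1)%N by lia.
pose q : LL d.+1 := plc d.+1 j.+1 (fun k => serL 0
  (fun m => serVL k i (- m.+1%:Z) (fun l => (l == 0%N)%:R))).
have cq e : mcoef q e = ([&& others d.+1 i j.+1 e, 0 <= e j.+1 & e i == - (e j.+1 + 1)])%:R.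
  rewrite mcoef_plc // mcoefS coef_serL subr0.
  case: (leP 0 (e j.+1)) => hj /=; last by rewrite mcoef0 if_same andbF.
  rewrite mcoef_serVL // absz_eq0 /=.
  case: (asboolP (forall k, (j.+1 < k < d.+1)%N -> _)) => H; last first.
    rewrite (_ : others _ _ _ _ = false) //; apply: asboolF => H'; apply: H => k /andP[l1 l2].
    by apply: H'; lia.
  case: (asboolP (forall k, (k < j.+1)%N -> _)) => H1 /=; last first.
    rewrite (_ : others _ _ _ _ = false) //; apply: asboolF => H'; apply: H1 => k l1 l2.
    by apply: H'; lia.
  rewrite (_ : others _ _ _ _ = true) /=; last first.
    apply: asboolT => k l1 n1 n2; case: (ltngtP k j.+1) => [l2|l2|//]; first exact: H1.
    by apply: H; rewrite l2.
  case: ifP => [l|l]; first by congr (nat_of_bool _)%:R; lia.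
  by rewrite (_ : (_ == _) = false) //; lia.
exists q.
  apply: mcoefP => e; rewrite mulrC mulrBl mcoefB !mcoef_varM // !cq mcoef1.
  have nij : (i == j.+1) = false by lia.
  have od k : (k == i) || (k == j.+1) -> others d.+1 i j.+1 (dec k e) = others d.+1 i j.+1 e.
    move=> Hk; apply: asbool_equiv_eq; split=> H l ltl n1 n2; have := H l ltl n1 n2;
      by rewrite /dec; case: eqP => // E; move: Hk; rewrite -E => /orP[]/eqP.
  rewrite !od ?eqxx ?orbT // /dec !eqxx nij eq_sym nij.
  case: (asboolP (forall k, (k < d.+1)%N -> e k = 0)) => [H|H].
    rewrite (H i) // (H j.+1) //= (_ : others _ _ _ _ = true) //= ?subr0 //.
    by apply: asboolT => k l _ _; exact: H.
  case: (asboolP (others d.+1 i j.+1 e)) => [/asboolP Ho|/negP/negbTE ->]; last by rewrite subrr.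
  rewrite (_ : others _ _ _ _ = true) /=; last exact: asboolT.
  have nz : ~ (e i = 0 /\ e j.+1 = 0).
    move=> [e1 e2]; apply: H => k l; case: (k =P i) => [->//|n1].
    by case: (k =P j.+1) => [->//|n2]; exact: Ho.
  apply/eqP; rewrite subr_eq0; apply/eqP; congr (nat_of_bool _)%:R; lia.
move=> m; apply: mcoefP => e; rewrite mcoef_coef_at; last by lia.
rewrite cq mcoef_ser // ins_expE.
have Eb : j.+1 = bump i j by rewrite /bump leij.
rewrite Eb others_ins; last by lia.
rewrite ins_exp_bump ins_exp_bumpE; case: (others d j j e) => //=.
by case: ifP => hj //=; congr (nat_of_bool _)%:R; lia.
Qed.

Lemma pspow_X1 l m : pspow (@X1 R) l m = (m == l)%:R.
Proof.
elim: l m => [//|l IH] m /=; rewrite /psmul; case: m => [|m].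
  by rewrite big_ord_recl big_ord0 /X1 mul0r addr0.
rewrite 2!big_ord_recl big1 => [|i _]; last by rewrite /X1 mul0r.
by rewrite /X1 mul0r add0r mul1r addr0 IH /= subn1.
Qed.

Lemma pscomp_X1 (f : nat -> R) : pscomp f (@X1 R) = f.
Proof.
apply: funext => m; rewrite /pscomp big_ord_recr /= pspow_X1 eqxx mulr1 big1 ?add0r // => i _.
by rewrite pspow_X1 gtn_eqF ?mulr0.
Qed.

(** Coefficients of [F(u, g(v))]. For [g] without constant term, [g^l] starts in degree [l], which
    bounds [l] by [q]. *)
Definition fgl2 (a : nat -> nat -> R) (g : nat -> R) p q : R :=
  \sum_(l < q.+1) fglc a p l * pspow g l q.

Lemma phi_Fsub a d al be g : (al < d)%N -> (be < d)%N -> al <> be ->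
  phi (Fsub a d al (@X1 R) be g) = biser d al be (fgl2 a g).
Proof.
have key (cc : nat -> nat -> R) al' be' (h g' : nat -> R) F : (al' < be')%N -> (be' < d)%N ->
    (forall p q, \sum_(l < q.+1) pspow g' l q * pscomp (fun i => cc i l) h p = F p q) ->
    plc d be' (fun k => FioLL k cc al' h g') = biser d al' be' F.
  move=> lt ltd HF; have lta : (al' < d)%N by exact: ltn_trans ltd.
  apply: mcoefP => e; rewrite mcoef_plc // mcoef_biser //.
  rewrite mcoefS /FioLL coef_serL subr0 /bicoef.
  case: (leP 0 (e be')) => hb /=; last by rewrite mcoef0 if_same !andbF.
  rewrite andbT mcoef_sum.
  case: (asboolP (forall k, (be' < k < d)%N -> _)) => H; last first.
    rewrite (_ : others _ _ _ _ = false) //; apply: asboolF => H'; apply: H => k /andP[l1 l2].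
    by apply: H'; lia.
  transitivity (\sum_(l < (absz (e be')).+1) if others d al' be' e && (0 <= e al') then
      pspow g' l (absz (e be')) * pscomp (fun i => cc i l) h (absz (e al')) else 0).
    apply: eq_bigr => l _; rewrite mcoef_liftLLM mcoef_ser //.
    rewrite (_ : others d al' be' e = others be' al' al' e).
      by case: ifP; rewrite ?mulr0.
    apply: asbool_equiv_eq; split=> H' k l1 n1 n2; first by apply: H'; lia.
    by case: (ltngtP k be') => [l2|l2|//]; [exact: H' | apply: H; rewrite l2].
  by case: ifP => _; [rewrite -HF | rewrite big1].
move=> lta ltb ne; rewrite /Fsub; case: ifPn => [lt|nlt].
  rewrite phi_place -(@key (fglc a) al be (@X1 R) g) //.
    by congr plc; apply: functional_extensionality_dep => k; exact: phi_FioL.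
  by move=> p q; apply: eq_bigr => l _; rewrite pscomp_X1 mulrC.
rewrite phi_place biserC -(@key (fun i j => fglc a j i) be al g (@X1 R)) //; last 2 first.
- by lia.
- move=> p q; rewrite big_ord_recr big1 /= => [|i _]; rewrite pspow_X1; last first.
    by rewrite gtn_eqF ?mul0r.
  by rewrite eqxx add0r mul1r.
by congr plc; apply: functional_extensionality_dep => k; exact: phi_FioL.
Qed.

End Bivariate.

(** * The diagonal derivative of the formal difference *)

Lemma triangle_sum (V : nmodType) (B : nat -> nat -> V) N :
  \sum_(q < N) \sum_(i < q.+1) B i (q - i)%N = \sum_(i < N) \sum_(k < N - i) B i k.
Proof.
elim: N => [|N IH]; first by rewrite !big_ord0.
rewrite big_ord_recr /= IH [in RHS]big_ord_recr /= subSn // subnn big_ord1.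
rewrite [X in _ + X]big_ord_recr /= subnn addrA; congr (_ + _).
rewrite -big_split; apply: eq_bigr => i _ /=.
by rewrite subSn ?big_ord_recr //= ltnW.
Qed.

Section FormalGroup.
Variable R : comPzRingType.
Variables (a : nat -> nat -> R) (io : nat -> R).
Hypotheses (Hcomm : fgl_comm a) (Hassoc : fgl_assoc a) (Hio : is_formal_inverse a io).
Local Notation F := (fglc a).
Let phi2 := fgl2 a io.

Lemma fglc0 k : F 0%N k = (k == 1%N)%:R. Proof. by []. Qed.
Lemma fglc_r0 k : F k 0%N = (k == 1%N)%:R. Proof. by case: k. Qed.

Lemma pspow_io_lt l q : (q < l)%N -> pspow io l q = 0.
Proof.
elim: l q => [//|l IH] q ltq /=; rewrite /psmul big1 // => i _.
case: (nat_of_ord i) (ltn_ord i) => [|j] ltj; first by rewrite Hio.1 mul0r.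
by rewrite IH ?mulr0 //; lia.
Qed.

Lemma sum_pspow_io (G : nat -> R) q N : (q < N)%N ->
  \sum_(l < N) G l * pspow io l q = \sum_(l < q.+1) G l * pspow io l q.
Proof.
move=> lt; rewrite [RHS](big_ord_widen N (fun l => G l * pspow io l q)) //.
rewrite [LHS](bigID (fun l : 'I_N => (l < q.+1)%N)) /= [X in _ + X]big1 ?addr0 // => l.
by rewrite -leqNgt => le; rewrite pspow_io_lt ?mulr0.
Qed.

Lemma fgl2_diag m : \sum_(p < m.+1) phi2 p (m - p)%N = 0.
Proof.
rewrite -[RHS](Hio.2 m); apply: eq_bigr => p _.
rewrite [RHS](sum_pspow_io (F p)); last by have := ltn_ord p; lia.
by [].
Qed.

Lemma divdiff_fgl2_00 : divdiff phi2 0 0 = 1.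
Proof. by rewrite /divdiff /phi2 /fgl2 !big_ord1 /= mulr1. Qed.

Lemma ps2pow_lt k p q : (p + q < k)%N -> ps2pow F k p q = 0.
Proof.
elim: k p q => [//|k IH] p q lt /=; rewrite /ps2mul big1 // => i _; rewrite big1 // => j _.
have := ltn_ord i; have := ltn_ord j.
case: (nat_of_ord i) => [|i']; case: (nat_of_ord j) => [|j'] lj li;
  by [rewrite fglc0 mul0r | rewrite IH ?mulr0 //; lia].
Qed.

Lemma ps2pow0l k q : ps2pow F k 0 q = (q == k)%:R.
Proof.
elim: k q => [|k IH] q; first by [].
rewrite /= /ps2mul big_ord1; case: q => [|q].
  by rewrite big_ord1 fglc0 mul0r.
rewrite 2!big_ord_recl big1 => [|j _]; last by rewrite fglc0 lift0 mul0r.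
by rewrite !fglc0 mul0r add0r lift0 mul1r addr0 IH subn1.
Qed.

(** Derivative of [F(v,x)^(k+1)] at [v = 0]: since [F(0,x) = x], it is [(k+1) x^k] times the
    derivative of [F] in its first argument. *)
Lemma ps2pow1l k q : ps2pow F k.+1 1 q = if (k <= q)%N then k.+1%:R * F 1%N (q - k)%N else 0.
Proof.
elim: k q => [|k IH] q.
  rewrite /= /ps2mul big_ord_recl big_ord1 [X in X + _]big1 ?add0r => [|j _]; last first.
    by rewrite mulr0.
  rewrite big_ord_recr /= subnn mulr1 mul1r subn0 big1 ?add0r // => j _.
  by rewrite subn_eq0 leqNgt ltn_ord mulr0.
have -> : ps2pow F k.+2 = ps2mul F (ps2pow F k.+1) by [].
rewrite /ps2mul big_ord_recl big_ord1.
have -> : \sum_(j < q.+1) F (lift ord0 ord0 : 'I_2) j *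
    ps2pow F k.+1 (1 - (lift ord0 ord0 : 'I_2)) (q - j) =
    if (k < q)%N then F 1%N (q - k.+1)%N else 0.
  transitivity (\sum_(j < q.+1) F 1%N j * ((q - j)%N == k.+1)%:R).
    by apply: eq_bigr => j _; congr (_ * _); exact: ps2pow0l.
  case: ifPn => [lt|nlt].
    rewrite (bigD1 (inord (q - k.+1))) //= inordK; last by lia.
    rewrite subKn // eqxx mulr1 big1 ?addr0 // => j nj.
    rewrite (_ : (_ == _) = false) ?mulr0 //; apply/eqP => E; case/eqP: nj.
    by apply: val_inj; rewrite /= inordK; have := ltn_ord j; lia.
  rewrite big1 // => j _; rewrite (_ : (_ == _) = false) ?mulr0 //; lia.
have -> : \sum_(j < q.+1) F (ord0 : 'I_2) j * ps2pow F k.+1 (1 - (ord0 : 'I_2)) (q - j) =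
    if (k < q)%N then k.+1%:R * F 1%N (q - k.+1)%N else 0.
  case: q => [|q]; first by rewrite big_ord1 fglc0 mul0r.
  rewrite 2!big_ord_recl big1 => [|j _]; last by rewrite fglc0 !lift0 mul0r.
  by rewrite !fglc0 mul0r add0r lift0 mul1r addr0 subn0 subn1 IH subSS.
by case: ifP => _; rewrite ?addr0 // -[k.+2]addn1 natrD mulrDl mul1r.
Qed.

(* The coefficient of z^m in f(z, io(z)). *)
Definition substio (f : nat -> nat -> R) m : R :=
  \sum_(q < m.+1) \sum_(s < (m - q).+1) f q s * pspow io s (m - q)%N.

Lemma serL_pspow s : serL 0 (pspow io s) = serL 0 io ^+ s.
Proof. by elim: s => [|s IH]; rewrite ?serL1 // exprS -IH serLM. Qed.

Lemma coef_lvarX q (f : laurent R) x : coef (lvar R ^+ q * f) x = coef f (x - q%:Z).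
Proof.
elim: q x => [|q IH] x; first by rewrite mul1r subr0.
by rewrite exprS -mulrA coef_lvarM IH; congr coef; lia.
Qed.

Definition zy q s : laurent R := lvar R ^+ q * serL 0 io ^+ s.

Lemma coef_zy q s (m : nat) : coef (zy q s) m = if (q <= m)%N then pspow io s (m - q)%N else 0.
Proof.
rewrite coef_lvarX -serL_pspow coef_serL subr0.
have -> : (0 <= m%:Z - q%:Z) = (q <= m)%N by lia.
by case: ifP => // le; congr pspow; lia.
Qed.

Lemma coef_zy_lt q s x : x < 0 -> coef (zy q s) x = 0.
Proof. by move=> lt; rewrite coef_lvarX -serL_pspow coef_serL ifF //; lia. Qed.

Lemma substioE f (m N : nat) : (m < N)%N ->
  substio f m = \sum_(q < N) \sum_(s < N) f q s * coef (zy q s) m.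
Proof.
move=> ltm; rewrite /substio
  (big_ord_widen N (fun q => \sum_(s < (m - q).+1) f q s * pspow io s (m - q)%N)) //.
rewrite [RHS](bigID (fun l : 'I_N => (l < m.+1)%N)) /= [X in _ + X]big1 ?addr0.
  apply: eq_bigr => q ltq; rewrite -(@sum_pspow_io (f q) _ N); last by lia.
  by apply: eq_bigr => s _; rewrite coef_zy -ltnS ltq.
by move=> q; rewrite -leqNgt => ltq; rewrite big1 // => s _; rewrite coef_zy leqNgt ltq mulr0.
Qed.

(* F(z, io(z)) = 0 kills every multiple of F. *)
Lemma substioM g m : substio (ps2mul F g) m = 0.
Proof.
pose N := m.+1; rewrite (substioE _ (ltnSn m)) -/N.
(* [V] is a truncation of [F(z, io(z)) = 0], so it has no term of order below [N > m], and neither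
   has its product with [z^k io(z)^l]. *)
pose V := \sum_(i < N) \sum_(j < N) lcst (F i j) * zy i j.
have V0 (x : int) : x < N%:Z -> coef V x = 0.
  rewrite coef_sum; case: x => x ltx; last first.
    rewrite big1 // => i _; rewrite coef_sum big1 // => j _.
    by rewrite coef_lcstM coef_zy_lt ?mulr0.
  rewrite -[RHS](fgl2_diag x) -[RHS]/(substio F x) (substioE _ ltx).
  apply: eq_bigr => i _; rewrite coef_sum.
  by apply: eq_bigr => j _; rewrite coef_lcstM.
have E k l : \sum_(i < N) \sum_(j < N) F i j * coef (zy (i + k) (j + l)) m = 0.
  have : coef (zy k l * V) m = 0.
    rewrite (@coefM _ _ _ 0 0%N) ?big_ord0 // => x Hx; first exact: coef_zy_lt.
    by apply: V0; rewrite /N; lia.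
  move=> Vm; rewrite -[RHS]Vm mulr_sumr coef_sum; apply: eq_bigr => i _.
  rewrite mulr_sumr coef_sum; apply: eq_bigr => j _.
  by rewrite mulrCA coef_lcstM /zy (addnC i) (addnC j) !exprD mulrACA.
have zy0 q s : (N <= q + s)%N -> coef (zy q s) m = 0.
  move=> le; rewrite coef_zy; case: ifP => // lqm.
  by apply: pspow_io_lt; rewrite /N in le; lia.
pose B i k := \sum_(s < N) \sum_(j < s.+1) F i j * g k (s - j)%N * coef (zy (i + k) s) m.
transitivity (\sum_(q < N) \sum_(i < q.+1) B i (q - i)%N).
  apply: eq_bigr => q _; rewrite exchange_big; apply: eq_bigr => s _.
  rewrite /ps2mul mulr_suml; apply: eq_bigr => i _ /=.
  by rewrite mulr_suml subnKC // -ltnS.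
rewrite triangle_sum.
transitivity (\sum_(i < N) \sum_(k < N) \sum_(j < N) \sum_(l < N)
   F i j * g k l * coef (zy (i + k) (j + l)) m).
  apply: eq_bigr => i _.
  transitivity (\sum_(k < N) B i k).
    rewrite (big_ord_widen N (B i)) ?leq_subr // [RHS](bigID (fun k : 'I_N => (k < N - i)%N)) /=.
    rewrite [X in _ + X]big1 ?addr0 // => k; rewrite -leqNgt => le.
    rewrite /B big1 // => s _; rewrite big1 // => j _; rewrite zy0 ?mulr0 //; lia.
  apply: eq_bigr => k _; rewrite /B.
  pose C j l := F i j * g k l * coef (zy (i + k) (j + l)) m.
  transitivity (\sum_(s < N) \sum_(j < s.+1) C j (s - j)%N).
    by apply: eq_bigr => s _; apply: eq_bigr => j _; rewrite /C subnKC // -ltnS.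
  rewrite triangle_sum; apply: eq_bigr => j _.
  rewrite (big_ord_widen N (C j)) ?leq_subr // [RHS](bigID (fun k : 'I_N => (k < N - j)%N)) /=.
  rewrite [X in _ + X]big1 ?addr0 // => l; rewrite -leqNgt => le.
  rewrite zy0 ?mulr0 //; lia.
rewrite exchange_big big1 // => k _; rewrite (eq_bigr (fun i : 'I_N => \sum_(l < N) \sum_(j < N)
   F i j * g k l * coef (zy (i + k) (j + l)) m)); last by move=> i _; rewrite exchange_big.
rewrite exchange_big big1 // => l _.
rewrite -[RHS](mulr0 (g k l)) -[in RHS](E k l) mulr_sumr; apply: eq_bigr => i _.
rewrite mulr_sumr; apply: eq_bigr => j _; rewrite mulrA; congr (_ * _); exact: mulrC.
Qed.

(** On the diagonal a divided difference becomes the derivative in the first variable: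
    [phi2 q.+1 (m - q)] is met once for every [p <= q]. *)
Lemma divdiff_diag m : \sum_(p < m.+1) divdiff phi2 p (m - p)%N =
  \sum_(k < m.+1) k.+1%:R * phi2 k.+1 (m - k)%N.
Proof.
transitivity (\sum_(p < m.+1) \sum_(t < m.+1 - p) phi2 (p + t.+1)%N (m - p - t)%N).
  by apply: eq_bigr => p _; rewrite subSn // -ltnS.
rewrite -(triangle_sum (fun p t => phi2 (p + t.+1)%N (m - p - t)%N)).
apply: eq_bigr => q _; rewrite (eq_bigr (fun=> phi2 q.+1 (m - q)%N)) => [|i _].
  by rewrite sumr_const card_ord mulr_natl.
by have := ltn_ord i; have := ltn_ord q => ? ?; congr phi2; lia.
Qed.

(* Differentiating F(F(v,x), io x) = F(v, F(x, io x)) = v at v = 0. *)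
Lemma divdiff_P : psmul (fun m => \sum_(p < m.+1) divdiff phi2 p (m - p)%N)
    (fun k => if k == 0%N then 1 else a k 1%N) = fun m => (m == 0%N)%:R.
Proof.
apply: funext => m.
(* By commutativity, [P(z)] is the derivative of [F(v,z)] in [v] at [v = 0]. *)
have -> : (fun k => if k == 0%N then 1 else a k 1%N) = F 1%N.
  by apply: funext => -[|k] //=; rewrite Hcomm.
transitivity (\sum_(k < m.+1) \sum_(r < m.+1 - k)
    k.+1%:R * phi2 k.+1 (m - k - r)%N * F 1%N r).
  rewrite /psmul; transitivity (\sum_(j < m.+1) \sum_(k < j.+1)
      k.+1%:R * phi2 k.+1 (j - k)%N * F 1%N (m - k - (j - k))%N).
    apply: eq_bigr => j _; rewrite divdiff_diag mulr_suml; apply: eq_bigr => k _.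
    by congr (_ * F _ _); have := ltn_ord k; lia.
  rewrite (triangle_sum (fun k t => k.+1%:R * phi2 k.+1 t * F 1%N (m - k - t)%N)).
  apply: eq_bigr => k _; rewrite (reindex_inj rev_ord_inj) /=; apply: eq_bigr => r _.
  have := ltn_ord r; have := ltn_ord k => ltk ltr.
  by congr (_ * phi2 _ _ * F _ _); lia.
rewrite -(triangle_sum (fun k r => k.+1%:R * phi2 k.+1 (m - k - r)%N * F 1%N r)).
(* Chain rule: the product is the coefficient of [v] in [F(F(v,x), y)], with [y = io(x)] substituted
   afterwards. *)
transitivity (substio (fun q s => \sum_(k < q.+2) F k s * ps2pow F k 1 q) m).
  apply: eq_bigr => q _; rewrite (eq_bigr (fun s : 'I_(m - q).+1 =>
    \sum_(k < q.+2) F k s * ps2pow F k 1 q * pspow io s (m - q)%N)); last first.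
    by move=> s _; rewrite mulr_suml.
  rewrite exchange_big [RHS]big_ord_recl [X in _ = X + _]big1 ?add0r => [|s _]; last first.
    by rewrite /= mulr0 mul0r.
  apply: eq_bigr => k _; rewrite lift0.
  transitivity (phi2 k.+1 (m - q)%N * (k.+1%:R * F 1%N (q - k)%N)).
    rewrite (_ : (m - k - (q - k))%N = (m - q)%N); first by ring.
    by have := ltn_ord k; lia.
  rewrite mulr_suml; apply: eq_bigr => s _; rewrite ps2pow1l -ltnS ltn_ord.
  exact: mulrAC.
(* Associativity at exponent 1 of [v]. The range of [k] can be made independent of [q] and [s], as
   [F^k] has no terms below degree [k]. *)
transitivity (substio (fun q s => \sum_(k < m.+1) F 1%N k * ps2pow F k q s) m).
  apply: eq_bigr => q _; apply: eq_bigr => s _; congr (_ * _).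
  have := Hassoc 1 q s; rewrite add1n => ->.
  have le : ((q + s).+1 <= m.+1)%N by have := ltn_ord s; have := ltn_ord q; lia.
  rewrite (big_ord_widen m.+1 (fun k => F 1%N k * ps2pow F k q s)) //.
  rewrite [RHS](bigID (fun k : 'I_m.+1 => (k < (q + s).+1)%N)) /=.
  rewrite [X in _ = _ + X]big1 ?addr0 // => k; rewrite -leqNgt => lt.
  by rewrite ps2pow_lt ?mulr0.
transitivity (\sum_(k < m.+1) F 1%N k * substio (ps2pow F k) m).
  rewrite /substio; under [RHS]eq_bigr => k _ do rewrite mulr_sumr.
  rewrite [RHS]exchange_big; apply: eq_bigr => q _ /=.
  under [RHS]eq_bigr => k _ do rewrite mulr_sumr.
  rewrite [RHS]exchange_big; apply: eq_bigr => s _ /=.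
  by rewrite mulr_suml; apply: eq_bigr => k _; rewrite mulrA.
(* The terms [k > 0] are multiples of [F(x, io(x)) = 0]; the term [k = 0] is the coefficient of [v]
   in [F(v,0) = v]. *)
rewrite big_ord_recl big1 ?addr0 => [|k _]; last by rewrite lift0 /= substioM mulr0.
rewrite fglc_r0 mul1r /substio big_ord_recl [X in _ + X]big1 ?addr0 => [|q _]; last first.
  by rewrite big1 // => s _; rewrite /= mul0r.
rewrite big_ord_recl big1 ?addr0 => [|s _]; last by rewrite /= mul0r.
by rewrite /= mul1r subn0.
Qed.

End FormalGroup.

(** * The residue step *)

Lemma congr2_mul (A : pzSemiRingType) (x y x' y' : A) :
  x = x' -> y = y' -> x * y = x' * y'.
Proof. by move=> -> ->. Qed.

Lemma prod_ltS (A : comPzRingType) (G : nat -> nat -> A) r :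
  \prod_(i < r.+1) \prod_(j < r.+1 | (i < j)%N) G i j =
  (\prod_(j < r) G 0%N j.+1) * \prod_(i < r) \prod_(j < r | (i < j)%N) G i.+1 j.+1.
Proof.
rewrite big_ord_recl /= [in LHS]big_mkcond big_ord_recl /= mul1r.
congr (_ * _); apply: eq_bigr => i _; rewrite big_mkcond big_ord_recl /= mul1r.
by rewrite [RHS]big_mkcond.
Qed.

Lemma prod_rem (A : comPzRingType) (I : seq nat) (G : nat -> A) j :
  j \in I -> uniq I -> \prod_(k <- I) G k = G j * \prod_(k <- I | k != j) G k.
Proof. exact: bigD1_seq. Qed.

Lemma prod_split_seq (A : comPzRingType) (I : seq nat) (P : pred nat) (T U V : nat -> A) :
  {in I, forall k, P k -> T k = U k * V k} ->
  \prod_(k <- I | P k) T k = (\prod_(k <- I | P k) U k) * \prod_(k <- I | P k) V k.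
Proof.
move=> H; rewrite -big_split big_seq_cond [RHS]big_seq_cond; apply: eq_bigr => k /andP[].
exact: H.
Qed.

Lemma prod_cancel (A : comPzRingType) r (S T P U W : 'I_r -> A) :
  (forall i, T i * S i = 1) -> (forall i, W i = T i * U i) ->
  (\prod_i S i) * (\prod_i (P i * W i)) = \prod_i (P i * U i).
Proof.
move=> TS WE; rewrite -big_split; apply: eq_bigr => i _; rewrite /= WE.
have -> : S i * (P i * (T i * U i)) = P i * U i * (T i * S i) by ring.
by rewrite TS mulr1.
Qed.

(** * Inverses and partial fractions in a commutative ring *)

Section Inverse.
Variable A : comPzRingType.
Implicit Types x y : A.

(* Junk when x is not a unit. *)
Definition linv x : A := xget 0 [set y | x * y = 1]%classic.

Definition invertible x : Prop := exists y, x * y = 1.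

Lemma linvE x y : x * y = 1 -> linv x = y.
Proof.
move=> E; rewrite /linv; case: xgetP => [z _ /= Ez|/(_ y)]; last by case.
by rewrite -[z]mul1r -E mulrAC Ez mul1r.
Qed.

Lemma mulVx x : invertible x -> x * linv x = 1.
Proof. by move=> [y E]; rewrite (linvE E). Qed.

Lemma linvM x y : invertible x -> invertible y -> linv (x * y) = linv x * linv y.
Proof. by move=> /mulVx Ex /mulVx Ey; apply: linvE; rewrite mulrACA Ex Ey mulr1. Qed.

(** The induction hypothesis is used twice: at [u], and at [x i] with [D i] for [q], which expands
    the coefficient of [q i]. It then remains that [q_i q_j = D_ji (q_j - q_i)]. The witness [j0]
    excludes the empty list, where the sides are 1 and 0. *)
Lemma partial_fractions (x : nat -> A) (I : seq nat) (j0 : nat) (u : A) (q : nat -> A)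
    (D : nat -> nat -> A) :
  j0 \in I -> uniq I ->
  {in I, forall k, q k * (u - x k) = 1} ->
  {in I &, forall j k, j != k -> D j k * (x j - x k) = 1} ->
  \prod_(k <- I) q k = \sum_(j <- I) (\prod_(k <- I | k != j) D j k) * q j.
Proof.
elim: I j0 u q => [//|i I IH] j0 u q _ /= /andP[niI uI] Hq HD.
have Hq' : {in I, forall k, q k * (u - x k) = 1}.
  by move=> k kI; apply: Hq; rewrite inE kI orbT.
have HD' : {in I &, forall j k, j != k -> D j k * (x j - x k) = 1}.
  by move=> j k jI kI; apply: HD; rewrite inE ?jI ?kI orbT.
have iI : i \in i :: I by rewrite inE eqxx.
have in_cons k : k \in I -> k \in i :: I by move=> kI; rewrite inE kI orbT.
have ne k : k \in I -> k != i by move=> kI; apply: contraNneq niI => <-.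
have prodi : \prod_(k <- i :: I | k != i) D i k = \prod_(k <- I) D i k.
  rewrite big_cons eqxx /= big_seq_cond [RHS]big_seq_cond; apply: eq_bigl => k.
  by rewrite andbT; case kI: (k \in I); rewrite //= ne.
case: (posnP (size I)) => [/size0nil I0|].
  by rewrite big_cons [RHS]big_cons prodi I0 !big_nil mul1r mulr1 addr0.
case EI: I => [//|j1 I1] _; rewrite -EI.
have j1I : j1 \in I by rewrite EI inE eqxx.
rewrite big_cons [RHS]big_cons prodi (IH j1 u q) //.
rewrite (IH j1 (x i) (D i)) //; last first.
  by move=> k kI; apply: HD => //; [exact: in_cons | rewrite eq_sym ne].
rewrite mulr_sumr mulr_suml -big_split /= big_seq [RHS]big_seq.
apply: eq_bigr => j jI; rewrite big_cons eq_sym (ne j jI).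
set P := \prod_(k <- I | _) _.
have E1 := HD _ _ iI (in_cons _ jI); rewrite eq_sym (ne j jI) in E1.
have E2 := HD _ _ (in_cons _ jI) iI (ne j jI).
have E3 := Hq _ (in_cons _ jI); have E4 := Hq _ iI.
have -> : D i j = - D j i.
  have : D i j * (D j i * (x j - x i)) = - D j i * (D i j * (x i - x j)) by ring.
  by rewrite E2 (E1 isT) !mulr1.
have -> : q i * (P * q j) = P * (D j i * (x j - x i)) * (q i * q j) by rewrite E2; ring.
have -> : P * (D j i * (x j - x i)) * (q i * q j) =
  P * D j i * (q j * (q i * (u - x i)) - q i * (q j * (u - x j))) by ring.
by rewrite E3 E4; ring.
Qed.

End Inverse.

Lemma linv_rmorph (A B : comPzRingType) (f : {rmorphism A -> B}) x :
  invertible x -> linv (f x) = f (linv x).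
Proof. by move=> /mulVx E; apply: linvE; rewrite -rmorphM E rmorph1. Qed.

Section Residue.
Variable R : comPzRingType.
Variables (a : nat -> nat -> R) (io : nat -> R).
Hypotheses (Hcomm : fgl_comm a) (Hassoc : fgl_assoc a) (Hio : is_formal_inverse a io).
Local Notation LL := (LL R).

Definition fplus d al be : LL d := biser d al be (fgl2 a (@X1 R)).
Definition fminus d al be : LL d := biser d al be (fgl2 a io).
Definition fdiff d al be : LL d := biser d al be (divdiff (fgl2 a io)).

Lemma io1 : -1 * io 1%N = 1.
Proof.
have := Hio.2 1%N; rewrite !big_ord_recl !big_ord0 /= /psmul !big_ord_recl !big_ord0 /=.
rewrite Hio.1 !(mul0r, mul1r, mulr0, mulr1, add0r, addr0) => H.
have {}H : io 1%N + 1 = 0 := H.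
by rewrite mulN1r; apply/eqP; rewrite eqr_oppLR -subr_eq0 opprK H.
Qed.

Lemma phi_inv_fplus d al be : (al < d)%N -> (be < d)%N -> al <> be ->
  fplus d al be * phi (Fsubinv a d al (@X1 R) (@hqX R) be (@X1 R) (@hqX R)) = 1.
Proof.
move=> lta ltb ne; rewrite /fplus -phi_Fsub //; apply: Fsub_inv => //; by rewrite mulr1.
Qed.

Lemma phi_inv_fminus d al be : (al < d)%N -> (be < d)%N -> al <> be ->
  fminus d al be * phi (Fsubinv a d al (@X1 R) (@hqX R) be io (hqio io)) = 1.
Proof.
move=> lta ltb ne; rewrite /fminus -phi_Fsub //; apply: Fsub_inv => //.
- by rewrite mulr1.
- exact: Hio.1.
- exact: io1.
Qed.

Lemma fplus_inv d al be : (al < d)%N -> (be < d)%N -> al <> be -> invertible (fplus d al be).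
Proof. move=> *; eexists; exact: phi_inv_fplus. Qed.

Lemma fminus_inv d al be : (al < d)%N -> (be < d)%N -> al <> be -> invertible (fminus d al be).
Proof. move=> *; eexists; exact: phi_inv_fminus. Qed.

(** The inverse is expanded in the outer variable, from exponent 0 on. With [be] the level of [u_1],
    the factors between [u_1] and the other [u_i] thus have no pole in [u_1]. *)
Lemma regular_linv_fplus d al be : (al < be)%N -> (be < d)%N ->
  regular_at be (linv (fplus d al be)).
Proof.
move=> lt ltd; rewrite (linvE (phi_inv_fplus _ _ _)) //; try lia.
rewrite /Fsubinv lt phi_place => e elt; rewrite mcoef_plc //.
case: ifP => // _; rewrite /sinv phi_ser mcoefS coef_serL ifF ?mcoef0 //.
by move: elt; rewrite /=; lia.
Qed.

Lemma fdiff_inv d al be : (al < d)%N -> (be < d)%N ->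
  invertible (fdiff d al be) /\ power (linv (fdiff d al be)).
Proof.
move=> lta ltb; have [g Hg E] := biser_inv lta ltb (divdiff_fgl2_00 a io).
by split; [exists g | rewrite (linvE E)].
Qed.

Lemma fminusE d al be : (al < d)%N -> (be < d)%N -> al <> be ->
  fminus d al be = (var R d al - var R d be) * fdiff d al be.
Proof. by move=> *; apply: biser_divdiff => //; exact: fgl2_diag. Qed.

Lemma varB_inv d al be : (al < d)%N -> (be < d)%N -> al <> be ->
  invertible (var R d al - var R d be).
Proof.
move=> lta ltb ne; exists (fdiff d al be * linv (fminus d al be)).
by rewrite mulrA -fminusE // mulVx //; exact: fminus_inv.
Qed.

Lemma linv_fminus d al be : (al < d)%N -> (be < d)%N -> al <> be ->
  linv (fminus d al be) = linv (var R d al - var R d be) * linv (fdiff d al be).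
Proof.
move=> lta ltb ne; rewrite fminusE // linvM //; first exact: varB_inv.
by have [] := fdiff_inv lta ltb.
Qed.

Definition tfac d al be : LL d := fplus d al be * linv (fminus d al be).
Definition sfac d al be : LL d := fminus d al be * linv (fplus d al be).

Lemma tsfac d al be : (al < d)%N -> (be < d)%N -> al <> be ->
  tfac d al be * sfac d al be = 1.
Proof.
move=> lta ltb ne; rewrite /tfac /sfac.
have := mulVx (fplus_inv lta ltb ne); have := mulVx (fminus_inv lta ltb ne).
set x := fplus _ _ _; set y := fminus _ _ _ => E1 E2.
have -> : x * linv y * (y * linv x) = (y * linv y) * (x * linv x) by ring.
by rewrite E1 E2 mulr1.
Qed.

Lemma ins_at_tfac i d al be : (i <= d)%N -> (al < d)%N -> (be < d)%N -> al <> be ->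
  ins_at i (tfac d al be) = tfac d.+1 (bump i al) (bump i be).
Proof.
move=> lei lta ltb ne; rewrite /tfac rmorphM /= -linv_rmorph; last exact: fminus_inv.
by congr (_ * linv _); exact: ins_at_biser.
Qed.

Lemma ins_at_sfac i d al be : (i <= d)%N -> (al < d)%N -> (be < d)%N -> al <> be ->
  ins_at i (sfac d al be) = sfac d.+1 (bump i al) (bump i be).
Proof.
move=> lei lta ltb ne; rewrite /sfac rmorphM /= -linv_rmorph; last exact: fplus_inv.
by congr (_ * linv _); exact: ins_at_biser.
Qed.

(* The generating function with the x-variables restricted to the index set I;
   u_(i+1) is the variable of level r - 1 - i and x_(k+1) that of level r + k. *)
Definition gen d r (I : seq nat) : LL d :=
  (\prod_(i < r) (serVL d (r - 1 - i) 0 (Pinv a) *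
                  \prod_(k <- I) tfac d (r - 1 - i) (r + k))) *
  \prod_(i < r) \prod_(j < r | (i < j)%N) sfac d (r - 1 - j) (r - 1 - i).

(** [u_1] has the highest level among the [u_i]: deleting it keeps the levels of the others and
    lowers those of the [x] by one. What does not involve [u_1] is therefore a smaller generating
    function with a layer inserted at [r]. *)
Lemma genS d r I : (r <= d)%N -> {in I, forall k, (r + k < d)%N} ->
  gen d.+1 r.+1 I =
  serVL d.+1 r 0 (Pinv a) * \prod_(k <- I) tfac d.+1 r (bump r (r + k)) *
  \prod_(j < r) sfac d.+1 (bump r j) r * ins_at r (gen d r I).
Proof.
move=> lerd HI; have bl j : (j < r)%N -> bump r j = j by move=> lt; rewrite /bump leqNgt lt.
have bx k : bump r (r + k) = (r.+1 + k)%N by rewrite /bump leq_addr.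
have Ex (i : 'I_r) : (r.+1 - 1 - lift ord0 i)%N = (r - 1 - i)%N by rewrite lift0; lia.
have E0 : (r.+1 - 1 - (ord0 : 'I_r.+1))%N = r by rewrite /=; lia.
rewrite /gen rmorphM /=.
have -> : \prod_(i < r.+1) (serVL d.+1 (r.+1 - 1 - i) 0 (Pinv a) *
      \prod_(k <- I) tfac d.+1 (r.+1 - 1 - i) (r.+1 + k)) =
    serVL d.+1 r 0 (Pinv a) * \prod_(k <- I) tfac d.+1 r (bump r (r + k)) *
    ins_at r (\prod_(i < r) (serVL d (r - 1 - i) 0 (Pinv a) *
                  \prod_(k <- I) tfac d (r - 1 - i) (r + k))).
  rewrite big_ord_recl E0; apply: congr2_mul.
    by apply: congr2_mul; [reflexivity | apply: eq_bigr => k _; rewrite bx].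
  rewrite rmorph_prod; apply: eq_bigr => i _; rewrite rmorphM rmorph_prod Ex /=.
  have lti := ltn_ord i; apply: congr2_mul.
    have := @ins_at_ser R r d (r - 1 - i) (Pinv a) lerd; rewrite bl; last by lia.
    by move=> -> //; lia.
  apply: eq_big_seq => k /HI ltk.
  have := @ins_at_tfac r d (r - 1 - i) (r + k) lerd; rewrite bl ?bx; last by lia.
  by move=> -> //; lia.
have -> : \prod_(i < r.+1) \prod_(j < r.+1 | (i < j)%N)
      sfac d.+1 (r.+1 - 1 - j) (r.+1 - 1 - i) =
   \prod_(j < r) sfac d.+1 (bump r j) r *
   ins_at r (\prod_(i < r) \prod_(j < r | (i < j)%N) sfac d (r - 1 - j) (r - 1 - i)).
  have -> := prod_ltS (fun i j => sfac d.+1 (r.+1 - 1 - j) (r.+1 - 1 - i)) r.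
  apply: congr2_mul.
    rewrite [RHS](reindex_inj rev_ord_inj); apply: eq_bigr => j _.
    have ltj := ltn_ord j; rewrite bl /=; last by lia.
    by apply: (f_equal2 (sfac d.+1)); lia.
  rewrite rmorph_prod; apply: eq_bigr => i _; rewrite rmorph_prod /=.
  apply: eq_bigr => j ltij; have ltj := ltn_ord j; have lti := ltn_ord i.
  have := @ins_at_sfac r d (r - 1 - j) (r - 1 - i) lerd; rewrite !bl; try lia.
  move=> ->; try lia.
  by apply: (f_equal2 (sfac d.+1)); lia.
by rewrite mulrACA mulrA.
Qed.

Definition diagplus m : R := \sum_(p < m.+1) fgl2 a (@X1 R) p (m - p)%N.
Definition diagdiff m : R := \sum_(p < m.+1) divdiff (fgl2 a io) p (m - p)%N.
Definition Pser k : R := if k == 0%N then 1 else a k 1%N.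

Lemma serVL_Pinv d al : (al < d)%N -> serVL d al 0 Pser * serVL d al 0 (Pinv a) = 1.
Proof. by move=> lt; rewrite serVLM // /Pinv /psinv psmul_ginv ?mulr1 // serVL1. Qed.

Lemma serVL_diagdiff d al : (al < d)%N -> serVL d al 0 diagdiff * serVL d al 0 Pser = 1.
Proof. by move=> lt; rewrite serVLM // divdiff_P // serVL1. Qed.

(** The two factors have separate origins in the residue: [F(x,x)] is a value at [u = x], and [x^m]
    is the coefficient of [u^-(m+1)] in [1/(u - x)]. *)
Lemma serVL_brk d al m : (al < d)%N ->
  serVL d al 0 (brk a m.+1) = serVL d al 0 diagplus * serVL d al 0 (fun k => (k == m)%:R).
Proof.
move=> lt; rewrite serVLM //; apply: (f_equal (serVL d al 0)); rewrite /brk /=.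
have -> : pspow (@X1 R) m = fun k => (k == m)%:R by apply: funext => k; exact: pspow_X1.
apply: (f_equal (fun f => psmul f _)); apply: funext => k; apply: eq_bigr => p _.
rewrite /fgl2 big_ord_recr big1 /= => [|l _]; rewrite pspow_X1.
  by rewrite eqxx mulr1 add0r.
by rewrite gtn_eqF ?mulr0.
Qed.

Section Step.
Variables (d r : nat) (I : seq nat).
Hypotheses (lerd : (r <= d)%N) (uI : uniq I) (HI : {in I, forall k, (r + k < d)%N}).
Local Notation lx k := (r + k)%N.

Let bl j : (j < r)%N -> bump r j = j.
Proof. by move=> lt; rewrite /bump leqNgt lt. Qed.
Let bX k : bump r (lx k) = (lx k).+1.
Proof. by rewrite /bump leq_addr. Qed.
Let neX k : r <> bump r (lx k).
Proof. by apply/eqP; rewrite neq_bump. Qed.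
Let ltX k : k \in I -> (bump r (lx k) < d.+1)%N.
Proof. by move=> /HI; rewrite bX. Qed.
Let neXX j k : k != j -> lx j <> lx k.
Proof. by move=> /eqP ne /addnI E; apply: ne. Qed.

(** What remains of the factors containing [u_1] once the poles [1/(u_1 - x_k)] are split off: a
    series regular in [u_1]. *)
Definition numer : LL d.+1 := serVL d.+1 r 0 (Pinv a) *
  (\prod_(k <- I) (fplus d.+1 r (bump r (lx k)) * linv (fdiff d.+1 r (bump r (lx k))))) *
  \prod_(j < r) sfac d.+1 (bump r j) r.

Definition pole k : LL d.+1 := linv (var R d.+1 r - var R d.+1 (bump r (lx k))).

Lemma numer_pole :
  serVL d.+1 r 0 (Pinv a) * \prod_(k <- I) tfac d.+1 r (bump r (lx k)) *
  \prod_(j < r) sfac d.+1 (bump r j) r = numer * \prod_(k <- I) pole k.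
Proof.
rewrite (@prod_split_seq _ _ _ _
  (fun k => fplus d.+1 r (bump r (lx k)) * linv (fdiff d.+1 r (bump r (lx k)))) pole).
  by rewrite /numer; set x := serVL _ _ _ _; set y := bigop.body _ _ _; set z := bigop.body _ _ _;
     set w := bigop.body _ _ _; rewrite !mulrA [x * y * z * w]mulrAC.
move=> k kI _; rewrite /tfac linv_fminus //; last exact: ltX.
by rewrite [in RHS]mulrAC mulrA.
Qed.

Lemma regular_sfac j : (j < r)%N -> regular_at r (sfac d.+1 (bump r j) r).
Proof.
move=> ltj; have ltj' : (bump r j < d.+1)%N by rewrite bl //; lia.
apply: regular_atM => //; first exact: power_biser.
by apply: regular_linv_fplus => //; rewrite bl.
Qed.

Lemma sim_sfac j i : j \in I -> (i < r)%N ->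
  sim r (var R d (lx j)) (sfac d.+1 (bump r i) r) (sfac d i (lx j)).
Proof.
move=> jI lti; have ltj := HI jI; have ltid : (i < d)%N by lia.
have lti' : (bump r i < d.+1)%N by rewrite bl //; lia.
have neij : i <> lx j by lia.
(* Here [u_1] is the second argument, whereas [sim_biser] substitutes into the first. *)
have S F : sim r (var R d (lx j)) (biser d.+1 (bump r i) r F) (biser d i (lx j) F).
  by rewrite biserC [X in sim _ _ _ X]biserC; exact: sim_biser.
apply: simM => //; first exact: S.
have neir : bump r i <> r by apply/eqP; rewrite eq_sym neq_bump.
apply: (sim_inv lerd (S (fgl2 a (@X1 R)))).
- by apply: regular_linv_fplus => //; rewrite bl.
- by apply: mulVx; exact: fplus_inv.
- by apply: mulVx; exact: fplus_inv.
Qed.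

Lemma sim_fplus j k : j \in I -> k \in I -> k != j ->
  sim r (var R d (lx j))
    (fplus d.+1 r (bump r (lx k)) * linv (fdiff d.+1 r (bump r (lx k))))
    (fplus d (lx j) (lx k) * linv (fdiff d (lx j) (lx k))).
Proof.
move=> jI kI ne; have ltj := HI jI; have ltk := HI kI.
have neX' : lx k <> lx j by move=> E; apply: (neXX ne).
have [i1 p1] := @fdiff_inv d.+1 r (bump r (lx k)) lerd (ltX kI).
have [i2 p2] := @fdiff_inv d (lx j) (lx k) ltj ltk.
apply: simM => //; first exact: sim_biser.
apply: (sim_inv lerd (sim_biser (divdiff (fgl2 a io)) lerd ltj ltk neX')).
- exact: p1.
- exact: mulVx.
- exact: mulVx.
Qed.

Lemma sim_fplus_diag j : j \in I ->
  sim r (var R d (lx j))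
    (fplus d.+1 r (bump r (lx j)) * linv (fdiff d.+1 r (bump r (lx j))))
    (serVL d (lx j) 0 diagplus * serVL d (lx j) 0 Pser).
Proof.
move=> jI; have ltj := HI jI.
have [i1 p1] := @fdiff_inv d.+1 r (bump r (lx j)) lerd (ltX jI).
apply: simM => //; first exact: sim_biser_diag.
apply: (sim_inv lerd (sim_biser_diag (divdiff (fgl2 a io)) lerd ltj)).
- exact: p1.
- exact: mulVx.
- exact: serVL_diagdiff.
Qed.

Definition value j : LL d := serVL d (lx j) 0 diagplus *
  (\prod_(k <- I | k != j) (fplus d (lx j) (lx k) * linv (fdiff d (lx j) (lx k)))) *
  \prod_(i < r) sfac d i (lx j).

(** This is where [1/P(u_1)] is needed: its value [1/P(x_j)] cancels [1/U(x_j,x_j) = P(x_j)], so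
    that only [F(x_j,x_j)] remains of the factors in [u_1] and [x_j]. *)
Lemma sim_numer j : j \in I -> sim r (var R d (lx j)) numer (value j).
Proof.
move=> jI; have ltj := HI jI.
have -> : value j = serVL d (lx j) 0 (Pinv a) *
  (serVL d (lx j) 0 diagplus * serVL d (lx j) 0 Pser *
   \prod_(k <- I | k != j) (fplus d (lx j) (lx k) * linv (fdiff d (lx j) (lx k)))) *
  \prod_(i < r) sfac d i (lx j).
  rewrite /value; have := serVL_Pinv ltj.
  set x := serVL _ _ _ _; set p := serVL _ _ _ _; set y := serVL _ _ _ _.
  set z := bigop.body _ _ _; set w := bigop.body _ _ _ => E.
  have -> : p * (y * x * z) * w = (x * p) * (y * z * w) by ring.
  by rewrite E mul1r.
rewrite /numer (prod_rem _ jI uI).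
apply: simM => //; last by apply: sim_prod => // i _ _; exact: sim_sfac.
apply: simM => //; first exact: sim_ser.
apply: simM => //; first exact: sim_fplus_diag.
by apply: sim_prod => // k kI ne; exact: sim_fplus.
Qed.

Lemma regular_numer : regular_at r numer.
Proof.
have reg_prod (J : Type) (s : seq J) (G : J -> LL d.+1) :
    (forall k, regular_at r (G k)) -> regular_at r (\prod_(k <- s) G k).
  move=> H; elim/big_ind: _ => [|u v|k _]; [exact: regular_at1 | exact: regular_atM | exact: H].
apply: regular_atM => //; last by apply: reg_prod => k; exact: regular_sfac.
apply: regular_atM => //.
  by move=> e elt; rewrite mcoef_ser // [0 <= _]leNgt elt andbF.
rewrite big_seq; elim/big_ind: _ => [|u v|k kI]; [exact: regular_at1 | exact: regular_atM |].
apply: regular_atM => //; first by apply: power_biser => //; exact: ltX.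
by have [_] := @fdiff_inv d.+1 r (bump r (lx k)) lerd (ltX kI); apply.
Qed.

Lemma poleP k : k \in I ->
  pole k * (var R d.+1 r - ins_at r (var R d (lx k))) = 1 /\
  forall m, coef_at r (- m.+1%:Z) (pole k) = serVL d (lx k) 0 (fun l => (l == m)%:R).
Proof.
move=> kI; have ltk := HI kI.
have [q Eq Hq] := @geometric R r (lx k) d (leq_addr _ _) ltk.
have Ep : pole k = q by apply: linvE; rewrite bX mulrC.
by rewrite ins_at_var // bX Ep.
Qed.

(** [sfac] is the reciprocal of [tfac], so the product cancels all factors of [gen] at [x_j]. It
    runs over levels while [gen] runs over indices, hence the reversal. *)
Lemma gen_rem j : j \in I ->
  (\prod_(i < r) sfac d i (lx j)) * gen d r I = gen d r [seq k <- I | k != j].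
Proof.
move=> jI; have ltj := HI jI; rewrite /gen mulrA; apply: congr2_mul; last by reflexivity.
rewrite (reindex_inj rev_ord_inj).
under [in RHS]eq_bigr => i _ do rewrite big_filter.
apply: (prod_cancel (T := fun i : 'I_r => tfac d (r - 1 - i) (lx j))) => i.
  have lti := ltn_ord i.
  have -> : (rev_ord i : nat) = (r - 1 - i)%N by rewrite /=; lia.
  by apply: tsfac; lia.
exact: (prod_rem (fun k => tfac d (r - 1 - i) (lx k))).
Qed.

(* Sum of the residues at u_1 = x_j. *)
Lemma coef_at_gen m : coef_at r (- m.+1%:Z) (gen d.+1 r.+1 I) =
  \sum_(j <- I) (serVL d (lx j) 0 (brk a m.+1) * \prod_(k <- I | k != j) tfac d (lx j) (lx k))
     * gen d r [seq k <- I | k != j].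
Proof.
rewrite genS // numer_pole mulrC coef_at_insM.
have mlt : - m.+1%:Z < 0 by [].
(* Without any [x] there is no pole: the negative coefficients of [numer] vanish, in accordance with
   the empty sum. *)
case: (posnP (size I)) => [/size0nil I0|].
  rewrite [in RHS]I0 big_nil [X in numer * X](_ : _ = 1); last by rewrite I0 big_nil.
  rewrite mulr1; have [H _] := @regular_atP R r d numer lerd.
  by rewrite (H regular_numer _ mlt) mulr0.
case EI: I => [//|j0 I'] _; rewrite -EI; have j0I : j0 \in I by rewrite EI inE eqxx.
pose D j k : LL d := linv (var R d (lx j) - var R d (lx k)).
have ED : {in I &, forall j k, j != k -> ins_at r (D j k) *
    (ins_at r (var R d (lx j)) - ins_at r (var R d (lx k))) = 1}.
  move=> j k jI kI ne; rewrite -rmorphB -rmorphM /D mulrC mulVx ?rmorph1 //.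
  by apply: varB_inv; [exact: HI | exact: HI | apply: neXX; rewrite eq_sym].
have Ep : {in I, forall k, pole k * (var R d.+1 r - ins_at r (var R d (lx k))) = 1}.
  by move=> k kI; have [] := poleP kI.
rewrite (@partial_fractions _ (fun k => ins_at r (var R d (lx k))) I j0 (var R d.+1 r) pole
  (fun j k => ins_at r (D j k)) j0I uI Ep ED).
rewrite mulr_sumr (raddf_sum (@coef_at R r _ d)) mulr_sumr.
apply: eq_big_seq => j jI /=; have ltj := HI jI.
have -> : numer * ((\prod_(k <- I | k != j) ins_at r (D j k)) * pole j) =
    ins_at r (\prod_(k <- I | k != j) D j k) * (numer * pole j).
  by rewrite rmorph_prod mulrCA.
have [Ej Cj] := poleP jI.
(* Each summand has the single pole [x_j]; the scalars [D j k = 1/(x_j - x_k)] then recombine with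
   the factors of [value j] into [tfac]. *)
rewrite coef_at_insM (coef_at_sim lerd (sim_numer jI) mlt Ej) Cj -gen_rem // serVL_brk //.
rewrite (@prod_split_seq _ I (fun k => k != j) (fun k => tfac d (lx j) (lx k))
  (fun k => fplus d (lx j) (lx k) * linv (fdiff d (lx j) (lx k))) (D j)).
  rewrite /value; set g := gen _ _ _; set x1 := bigop.body _ _ _; set x2 := serVL _ _ _ _.
  set x3 := bigop.body _ _ _; set x4 := bigop.body _ _ _; set x5 := serVL _ _ _ _; ring.
move=> k kI ne; rewrite /tfac linv_fminus; [by rewrite mulrA mulrAC | exact: ltj | exact: HI |].
by apply: neXX.
Qed.

End Step.

End Residue.

(** * Summation over coset representatives *)

Section Arrangements.
Variables (A : comPzRingType) (b t : nat -> nat -> A).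

(** Contribution of the permutation with one-line notation [l]. The product over all of [l']
    reflects that [j] runs up to [n], not [r], in the definition of the symmetrized sum. *)
Fixpoint weight (nu l : seq nat) : A :=
  match nu, l with
  | m :: nu', j :: l' => b m j * (\prod_(k <- l') t j k) * weight nu' l'
  | _, _ => 1
  end.

Fixpoint rec_sum (nu I : seq nat) : A :=
  match nu with
  | [::] => 1
  | m :: nu' => \sum_(j <- I) b m j * (\prod_(k <- I | k != j) t j k)
                  * rec_sum nu' [seq k <- I | k != j]
  end.

Lemma weight_nth nu l : (size nu <= size l)%N ->
  (\prod_(i < size l | (i < size nu)%N) b (nth 0%N nu i) (nth 0%N l i)) *
  (\prod_(i < size l) \prod_(j < size l | (i < size nu)%N && (i < j)%N)
     t (nth 0%N l i) (nth 0%N l j)) = weight nu l.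
Proof.
elim: nu l => [|m nu IH] [|j l] //=.
- by rewrite !big_ord0 mulr1.
- by rewrite big_pred0 // mul1r big1 // => i _; rewrite big_pred0.
rewrite ltnS => /IH <-; rewrite big_mkcond big_ord_recl /= -big_mkcond.
rewrite [X in _ * X]big_ord_recl /= [X in _ * (X * _)]big_mkcond.
rewrite [X in _ * (X * _)]big_ord_recl /= mul1r.
have -> : \prod_(k <- l) t j k = \prod_(k < size l) t j (nth 0%N l k).
  by rewrite (big_nth 0%N) big_mkord.
have -> : \prod_(i < size l) \prod_(k < (size l).+1 |
    (bump 0 i < (size nu).+1)%N && (bump 0 i < k)%N) t (nth 0%N l i) (nth 0%N (j :: l) k) =
  \prod_(i < size l) \prod_(k < size l | (i < size nu)%N && (i < k)%N)
    t (nth 0%N l i) (nth 0%N l k).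
  apply: eq_bigr => i _; rewrite big_mkcond big_ord_recl /= andbF mul1r.
  by rewrite -big_mkcond.
exact: mulrACA.
Qed.

Lemma sum_permutations (G : seq nat -> A) (I : seq nat) : uniq I -> (0 < size I)%N ->
  \sum_(l <- permutations I) G l =
  \sum_(j <- I) \sum_(l <- permutations [seq k <- I | k != j]) G (j :: l).
Proof.
move=> uI I0; rewrite (perm_big _ (permutationsE I0)) undup_id // big_allpairs_dep.
by apply: eq_bigr => j _; rewrite rem_filter.
Qed.

(** The recursion chooses [size nu] distinct indices in order; listing the unchosen ones
    increasingly completes the choice to a unique permutation of [I]. With nothing left to choose,
    sortedness singles out [I] itself. *)
Lemma rec_sumE nu I : sorted ltn I -> (size nu <= size I)%N ->
  rec_sum nu I = \sum_(l <- permutations I | sorted ltn (drop (size nu) l)) weight nu l.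
Proof.
elim: nu I => [|m nu IH] I sI szI.
  have := permutations_uniq I; rewrite /= => uP.
  have E : {in permutations I, (fun l => sorted ltn (drop 0 l)) =1 pred1 I}.
    move=> l; rewrite mem_permutations drop0 /= => pl.
    apply/idP/eqP => [sl|->//].
    by apply: (irr_sorted_eq ltn_trans ltnn sl sI); exact: perm_mem.
  rewrite big_seq_cond (eq_bigl (fun l => (l \in permutations I) && pred1 I l)) => [|l].
    by rewrite -big_seq_cond -big_filter filter_pred1_uniq ?big_seq1 // mem_permutations.
  by case lP: (l \in _) => //=; exact: E.
have uI : uniq I by apply: sorted_uniq sI; [exact: ltn_trans | exact: ltnn].
rewrite big_mkcond sum_permutations //; last by apply: leq_ltn_trans szI.
rewrite [LHS]/=; apply: eq_big_seq => j jI.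
have sj : sorted ltn [seq k <- I | k != j] by apply: sorted_filter sI; exact: ltn_trans.
have szj : (size nu <= size [seq k <- I | k != j])%N.
  by rewrite -(rem_filter _ uI) size_rem //; move: szI => /=; lia.
rewrite IH // -big_mkcond /= mulr_sumr big_seq_cond [RHS]big_seq_cond.
apply: eq_bigr => l /andP[]; rewrite mem_permutations => pl _.
by rewrite -big_filter (perm_big _ pl).
Qed.

End Arrangements.

(** * One-line notation and coset representatives *)

Section Codes.
Variable n : nat.

Definition code (w : {perm 'I_n}) : seq nat := [seq val (w i) | i <- enum 'I_n].

Lemma size_code w : size (code w) = n.
Proof. by rewrite size_map size_enum_ord. Qed.

Lemma nth_code w (i : 'I_n) : nth 0%N (code w) i = w i.
Proof. by rewrite (nth_map i) ?size_enum_ord // nth_ord_enum. Qed.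

Lemma code_inj : injective code.
Proof.
move=> w w' E; apply/permP => i; apply: val_inj.
by rewrite /= -!nth_code E.
Qed.

Lemma code_perm w : perm_eq (code w) (iota 0 n).
Proof.
apply: uniq_perm; rewrite ?iota_uniq //.
  by rewrite map_inj_uniq ?enum_uniq // => i j /val_inj /perm_inj.
move=> k; rewrite mem_iota add0n; apply/mapP/idP => [[i _ ->]|lt]; first exact: ltn_ord.
by exists ((w^-1)%g (Ordinal lt)); rewrite ?mem_enum // permKV.
Qed.

Lemma code_surj l : perm_eq l (iota 0 n) -> exists w, code w = l.
Proof.
move=> pl; have sl : size l = n by rewrite (perm_size pl) size_iota.
have ul : uniq l by rewrite (perm_uniq pl) iota_uniq.
have lt (i : 'I_n) : (nth 0%N l i < n)%N.
  have : nth 0%N l i \in iota 0 n by rewrite -(perm_mem pl) mem_nth // sl.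
  by rewrite mem_iota.
have inj : injective (fun i => Ordinal (lt i)).
  move=> i j [] /eqP; rewrite nth_uniq ?sl // => /eqP; exact: val_inj.
exists (perm inj); apply: (@eq_from_nth _ 0%N); rewrite size_code // => i ltn.
by rewrite (nth_code _ (Ordinal ltn)) permE.
Qed.

(** [coset_rep] compares all pairs of positions and [sorted] only neighbours; transitivity
    reconciles them. *)
Lemma coset_rep_code r w : coset_rep r w = sorted ltn (drop r (code w)).
Proof.
rewrite (sorted_pairwise ltn_trans); apply/forallP/(pairwiseP 0%N) => H.
  move=> i j; rewrite !inE size_drop size_code => lti ltj ltij; rewrite !nth_drop.
  have lti' : (r + i < n)%N by lia. have ltj' : (r + j < n)%N by lia.
  have /forallP/(_ (Ordinal ltj'))/implyP := H (Ordinal lti').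
  rewrite -!nth_code /=; apply; by rewrite leq_addr ltn_add2l.
move=> k; apply/forallP => k'; apply/implyP => /andP[lerk ltkk'].
have := H (k - r)%N (k' - r)%N; rewrite !inE size_drop size_code !nth_drop.
have := ltn_ord k; have := ltn_ord k' => lk' lk.
rewrite !subnKC //; last by lia.
by rewrite !nth_code; apply; lia.
Qed.

Lemma sum_code (A : comPzRingType) (G : seq nat -> A) r :
  \sum_(w <- enum {perm 'I_n} | coset_rep r w) G (code w) =
  \sum_(l <- permutations (iota 0 n) | sorted ltn (drop r l)) G l.
Proof.
rewrite -big_filter -[RHS]big_filter -(big_map code xpredT).
apply: perm_big; apply: uniq_perm.
- by rewrite (map_inj_uniq (@code_inj)) filter_uniq // enum_uniq.
- by rewrite filter_uniq // permutations_uniq.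
move=> l; rewrite mem_filter mem_permutations; apply/mapP/andP => [[w]|[sl pl]].
  by rewrite mem_filter coset_rep_code => /andP[sw _] ->; split=> //; exact: code_perm.
have [w Ew] := code_surj pl.
by exists w => //; rewrite mem_filter coset_rep_code Ew sl mem_enum.
Qed.

End Codes.

Lemma prod_iota (A : comPzRingType) (F : nat -> A) (P : pred nat) r :
  \prod_(i <- iota 0 r | P i) F i = \prod_(i < r | P i) F i.
Proof. by rewrite -(big_mkord P F) /index_iota subn0. Qed.

Lemma prod_enum (A : comPzRingType) n (F : 'I_n -> A) (P : pred 'I_n) :
  \prod_(i <- enum 'I_n | P i) F i = \prod_(i < n | P i) F i.
Proof. by rewrite big_enum_cond. Qed.

(** * From iterated residues to the symmetrized sum *)

Section Assembly.
Variable R : comPzRingType.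
Variables (a : nat -> nat -> R) (io : nat -> R).
Hypotheses (Hcomm : fgl_comm a) (Hassoc : fgl_assoc a) (Hio : is_formal_inverse a io).
Local Notation LL := (LL R).

(** Makes a series in the [x] a scalar for [ext]: the [u]-levels are inserted in the opposite order
    to that in which [ext] removes them. *)
Fixpoint insr (n r : nat) : LL n -> LL (r + n) :=
  match r return LL n -> LL (r + n) with
  | 0 => fun b => b
  | r'.+1 => fun b => @ins_at R r' (r' + n) (@insr n r' b)
  end.

Lemma insrM n r : {morph @insr n r : x y / x * y}.
Proof. by elim: r => [//|r IH] x y /=; rewrite IH rmorphM. Qed.

Lemma insr_prod n r (I : seq nat) (P : pred nat) F :
  insr r (\prod_(k <- I | P k) F k) = \prod_(k <- I | P k) @insr n r (F k).
Proof.
elim/big_rec2: _ => [|k x y _ <-]; last exact: insrM.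
by elim: r => [//|r IH] /=; rewrite IH rmorph1.
Qed.

Lemma insr_ser n r j c : (j < n)%N ->
  insr r (serVL n j 0 c : LL n) = serVL (r + n) (r + j) 0 c.
Proof.
move=> lt; elim: r => [//|r IH]; rewrite [insr _ _]/= IH ins_at_ser ?leq_addr ?ltn_add2l //.
by rewrite /bump leq_addr.
Qed.

Lemma insr_tfac n r j k : (j < n)%N -> (k < n)%N -> k != j ->
  insr r (tfac a io n j k) = tfac a io (r + n) (r + j) (r + k).
Proof.
move=> ltj ltk ne; elim: r => [//|r IH].
have neq : (r + j)%N <> (r + k)%N by move=> /addnI E; move: ne; rewrite E eqxx.
have lj : (r + j < r + n)%N by rewrite ltn_add2l.
have lk : (r + k < r + n)%N by rewrite ltn_add2l.
rewrite [insr _ _]/= IH (ins_at_tfac Hio (leq_addr n r) lj lk neq).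
by rewrite /bump !leq_addr.
Qed.

Fixpoint ext (n : nat) (nu : seq nat) : LL (size nu + n) -> LL n :=
  match nu return LL (size nu + n) -> LL n with
  | [::] => fun f => f
  | m :: nu' => fun f => @ext n nu' (@coef_at R (size nu') (- m%:Z) (size nu' + n) f)
  end.

Lemma extM n nu (b : LL n) f : ext (insr (size nu) b * f) = b * @ext n nu f.
Proof. by elim: nu f => [//|m nu IH] f /=; rewrite -IH; congr ext; exact: coef_at_insM. Qed.

Lemma ext_sum n nu (I : seq nat) F :
  @ext n nu (\sum_(j <- I) F j) = \sum_(j <- I) @ext n nu (F j).
Proof.
elim: nu F => [//|m nu IH] F /=; rewrite -IH; congr ext.
exact: (raddf_sum (@coef_at R (size nu) (- m%:Z) (size nu + n))).
Qed.

Lemma mcoef_ext n nu f e : mcoef (@ext n nu f) e = mcoef f (gen_exp nu e).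
Proof.
elim: nu f => [|m nu IH] f /=.
  by apply: eq_mcoef => k _; rewrite /gen_exp /= subn0.
rewrite IH mcoef_coef_at ?leq_addr //; apply: (@eq_mcoef _ (size nu + n).+1) => k _.
rewrite /ins_exp /gen_exp /=; case: (ltngtP k (size nu)) => [lt|lt|->].
- rewrite ltnS ltnW //; have -> : ((size nu).+1 - 1 - k = (size nu - 1 - k).+1)%N by lia.
  by [].
- by rewrite !ifF; [congr e; lia | lia | lia].
- by rewrite ltnSn subn1 subnn.
Qed.

(** The factors produced by one residue contain only [x]-variables, so [extM] moves them out of all
    later extractions. Positivity writes each part as [m.+1], the form to which [coef_at_gen]
    applies. *)
Lemma ext_gen n nu (I : seq nat) : all (fun m => (0 < m)%N) nu -> uniq I ->
  {in I, forall k, (k < n)%N} ->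
  ext (gen a io (size nu + n) (size nu) I) =
  rec_sum (fun m j => serVL n j 0 (brk a m)) (tfac a io n) nu I.
Proof.
elim: nu I => [|[//|m] nu IH] I /= Hpos uI HI.
  by rewrite /gen !big_ord0 mulr1.
rewrite coef_at_gen ?leq_addr //; last by move=> k /HI; rewrite ltn_add2l.
rewrite ext_sum; apply: eq_big_seq => j jI; have ltj := HI _ jI.
have Hf : {in [seq k <- I | k != j], forall k, (k < n)%N}.
  by move=> k; rewrite mem_filter => /andP[_ /HI].
rewrite -IH ?filter_uniq // -extM insrM insr_ser // insr_prod.
have -> : \prod_(k <- I | k != j) insr (size nu) (tfac a io n j k) =
   \prod_(k <- I | k != j) tfac a io (size nu + n) (size nu + j) (size nu + k).
  rewrite big_seq_cond [RHS]big_seq_cond; apply: eq_bigr => k /andP[kI ne].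
  by apply: insr_tfac => //; exact: HI.
by [].
Qed.

(** The explicit expansions of [Gen] become [linv] by uniqueness of inverses. *)
Lemma phi_Gen n nu :
  phi (Gen a io n nu) = gen a io (size nu + n) (size nu) (iota 0 n).
Proof.
rewrite /Gen phi_mul !phi_oprod /gen; apply: congr2_mul.
  rewrite prod_iota; apply: eq_bigr => i _; rewrite phi_mul phi_serV; apply: congr2_mul => //.
  rewrite phi_oprod; apply: eq_big_seq => j; rewrite mem_iota add0n => ltj.
  have lti := ltn_ord i; rewrite phi_mul phi_Fsub; try lia.
  apply: congr2_mul => //; apply/esym/linvE; apply: phi_inv_fminus => //; lia.
rewrite big_filter big_mkcond big_allpairs prod_iota; apply: eq_bigr => i _.
rewrite -big_mkcond prod_iota; apply: eq_bigr => j /= ltij.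
have lti := ltn_ord i; have ltj := ltn_ord j.
rewrite phi_mul phi_Fsub; try lia.
by apply: congr2_mul => //; apply/esym/linvE; apply: phi_inv_fplus; lia.
Qed.

Lemma phi_Qterm n nu (w : {perm 'I_n}) : (size nu <= n)%N ->
  phi (Qterm a io nu w) =
  weight (fun m j => serVL n j 0 (brk a m)) (tfac a io n) nu (code w).
Proof.
move=> len; rewrite -weight_nth size_code // /Qterm phi_mul !phi_oprod; apply: congr2_mul.
  rewrite big_filter prod_enum; apply: eq_bigr => i _.
  by rewrite phi_serV nth_code.
rewrite big_filter big_mkcond big_allpairs prod_enum; apply: eq_bigr => i _.
rewrite -big_mkcond prod_enum; apply: eq_bigr => j /andP[/= lti ltij].
have ne : (w i : nat) <> w j.
  by move=> /val_inj /perm_inj E; move: ltij; rewrite E ltnn.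
rewrite !nth_code phi_mul phi_Fsub //.
by apply: congr2_mul => //; apply/esym/linvE; exact: phi_inv_fminus.
Qed.

End Assembly.

Theorem mainTheorem7 (R : comPzRingType) (a : nat -> nat -> R) (io : nat -> R)
  (Hcomm : fgl_comm a) (Hassoc : fgl_assoc a) (Hio : is_formal_inverse a io)
  (n : nat) (nu : seq nat)
  (Hstrict : sorted (fun x y => (y < x)%N) nu)
  (Hpos : all (fun k => (0 < k)%N) nu)
  (Hlen : (size nu <= n)%N)
  (e : nat -> int) :
  coefT (QL a io n nu) e = coefT (Gen a io n nu) (gen_exp nu e).
Proof.
rewrite !coefTE phi_Gen // -mcoef_ext ext_gen ?iota_uniq //; last first.
  by move=> k; rewrite mem_iota.
rewrite rec_sumE ?iota_ltn_sorted ?size_iota // -sum_code /QL phi_osumL big_filter.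
apply: (f_equal (fun f => mcoef f e)).
by apply: eq_bigr => w _; exact: phi_Qterm.
Qed.
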